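(* Let $M=P+\varepsilon D \in \mathbb{DH}[t]$, $P,D\in\mathbb{H}[t]$, be a bounded, monic, reduced motion polynomial with $\deg M = n > 1$. Let $c=\operatorname{mrpf}(P)$, $\deg(c)>0$, $P = cQ$, and suppose $\nu(M)=N^{n}$ for a real, irreducible, quadratic polynomial $N$. Suppose that $g := \operatorname{mrpf}(c, Q^{*}D)$ divides $\operatorname{mrpf}(c, DQ^{*})$ and that $cg$ divides $\nu(D)$. Then the procedure Factor3 described in the context outputs a triple $(M_L,M_C,M_R)$ of monic motion polynomials such that $M = M_L M_C M_R$, where $M_L$ and $M_R$ are generic motion polynomials, $M_C= c + \varepsilon D'$ is a product of two generic motion polynomials, and $D'\in\mathbb{H}[t]$.
   Context: **Notation.** $\mathbb{H}$ denotes the real quaternions with conjugation $q\mapsto q^{*}$. The dual quaternions are $\mathbb{DH}=\mathbb{H}[\varepsilon]/(\varepsilon^2)$, where $\varepsilon$ commutes with everything, and $(p+\varepsilon d)^{*}=p^{*}+\varepsilon d^{*}$. In $\mathbb{DH}[t]$ and $\mathbb{H}[t]$ the indeterminate $t$ commutes with all coefficients; $M^{*}$ is obtained by conjugating all coefficients and $\nu(M):=MM^{*}$. Every $M\in\mathbb{DH}[t]$ is uniquely $M=P+\varepsilon D$ with $P,D\in\mathbb{H}[t]$; $P$ is the primal part. $M$ is a motion polynomial if $MM^{*}\in\mathbb{R}[t]\setminus\{0\}$. Monic means leading coefficient $1$. A real polynomial divides $M$ if it is a factor of $M$. $\operatorname{mrpf}(A,B)$ is the greatest common monic real polynomial divisor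 of $A$ and $B$; $\operatorname{mrpf}(M):=\operatorname{mrpf}(M,M)$, $\operatorname{mrpf}(0):=1$. $M$ is reduced if $\operatorname{mrpf}(M)=1$. A monic reduced motion polynomial $M=P+\varepsilon D$ is generic if $\operatorname{mrpf}(P)=1$, and bounded if $\operatorname{mrpf}(P)$ has no real zero (the constant $1$ is generic). For nonzero $A,B\in\mathbb{H}[t]$, $\operatorname{lgcd}(A,B)$ is the unique monic common left divisor of maximal degree. If $A=Q_lB+R_l$ with $\deg R_l<\deg B$, then $\operatorname{lquo}(A,B):=Q_l$. **Auxiliary procedure GFactor** (input: a generic monic motion polynomial $M$; output: a list of monic linear motion polynomials with product $M$). If $\deg M=0$, return the empty list. Otherwise choose an irreducible quadratic real factor $F$ of $\nu(M)$, let $r_1t+r_0$ be the remainder of $M$ on division by $F$, put $h:=-r_1^{-1}r_0$, and return the list GFactor$(\operatorname{lquo}(M,t-h))$ followed by $t-h$. **Procedure Factor3** (input: $M=cQ+\varepsilon D$ with $c,Q,N,g$ as in the claim). 1. If $\deg Q=0$, return $(1,M,1)$. 2. Otherwise put $Q_L:=\operatorname{lgcd}(g,Q)$. If $N$ divides $\frac1g Q^{*}D$, pick $q\in\mathbb{H}$ that does not commute with $p$, where $t-p=\operatorname{lgcd}(N,Q)$, and put $D_L:=qQ_L-Q_Lq$. If $N$ does not divide $\frac1g Q^{*}D$, put $D_L:=0$. 3. Put $D'_R:=\frac1g\left(cD_L^{*}Q+Q_L^{*}D\right)$ and $Q_R:=\frac{Q_L^{*}Q}{g}$. 4. Put $Q_c:=\operatorname{lgcd}(c,D'_R)$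 and $M_r:=Q_c^{*}Q_R+\varepsilon\,\frac{Q_c^{*}D'_R}{c}$. 5. Compute a factorization $M_r=L_1L_2\cdots L_{\deg M_r}$ into monic linear factors using GFactor. 6. Put $M_L:=Q_L+\varepsilon D_L$, $M_C:=Q_cL_1L_2\cdots L_{(\deg c)/2}$, $M_R:=L_{(\deg c)/2+1}\cdots L_{\deg M_r}$ (an empty product equals $1$), and return $(M_L,M_C,M_R)$. *)

(* Defs.v *)
From HB Require Import structures.
From mathcomp Require Import all_boot all_order all_algebra.
From mathcomp Require Import ring.
From mathcomp Require Import boolp classical_sets reals.

Set Implicit Arguments.
Unset Strict Implicit.
Unset Printing Implicit Defensive.

Import Order.TTheory GRing.Theory Num.Theory Pdiv.Ring.
Local Open Scope ring_scope.

(* Quat a b c d is a + b i + c j + d k. *)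
Record quat (R : Type) := Quat { qre : R; qi : R; qj : R; qk : R }.

Section QuatChoice.
Variable R : choiceType.

Definition quat_tuple (x : quat R) := (qre x, qi x, qj x, qk x).
Definition tuple_quat (t : R * R * R * R) :=
  let: (a, b, c, d) := t in Quat a b c d.

Lemma quat_tupleK : cancel quat_tuple tuple_quat.
Proof. by case. Qed.

HB.instance Definition _ := Choice.copy (quat R) (can_type quat_tupleK).
End QuatChoice.

Section QuatRing.
Variable R : realFieldType.
Implicit Types x y z : quat R.

Definition quat0 : quat R := Quat 0 0 0 0.
Definition quat1 : quat R := Quat 1 0 0 0.
Definition addq x y :=
  Quat (qre x + qre y) (qi x + qi y) (qj x + qj y) (qk x + qk y).
Definition oppq x := Quat (- qre x) (- qi x) (- qj x) (- qk x).
Definition scaleq (a : R) x := Quat (a * qre x) (a * qi x) (a * qj x) (a * qk x).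
Definition conjq x := Quat (qre x) (- qi x) (- qj x) (- qk x).
Definition mulq x y := Quat
  (qre x * qre y - qi x * qi y - qj x * qj y - qk x * qk y)
  (qre x * qi y + qi x * qre y + qj x * qk y - qk x * qj y)
  (qre x * qj y - qi x * qk y + qj x * qre y + qk x * qi y)
  (qre x * qk y + qi x * qj y - qj x * qi y + qk x * qre y).
Definition normq x := qre x ^+ 2 + qi x ^+ 2 + qj x ^+ 2 + qk x ^+ 2.
Definition invq x := scaleq (normq x)^-1 (conjq x).

Lemma addqA : associative addq.
Proof. by move=> [? ? ? ?] [? ? ? ?] [? ? ? ?]; congr Quat; rewrite /= addrA. Qed.
Lemma addqC : commutative addq.
Proof. by move=> [? ? ? ?] [? ? ? ?]; congr Quat; rewrite /= addrC. Qed.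
Lemma add0q : left_id quat0 addq.
Proof. by move=> [? ? ? ?]; congr Quat; rewrite /= add0r. Qed.
Lemma addNq : left_inverse quat0 oppq addq.
Proof. by move=> [? ? ? ?]; congr Quat; rewrite /= addNr. Qed.

HB.instance Definition _ := GRing.isZmodule.Build (quat R) addqA addqC add0q addNq.

Lemma mulqA : associative mulq.
Proof. by move=> [? ? ? ?] [? ? ? ?] [? ? ? ?]; congr Quat => /=; ring. Qed.
Lemma mul1q : left_id quat1 mulq.
Proof. by move=> [? ? ? ?]; congr Quat => /=; ring. Qed.
Lemma mulq1 : right_id quat1 mulq.
Proof. by move=> [? ? ? ?]; congr Quat => /=; ring. Qed.
Lemma mulqDl : left_distributive mulq addq.
Proof. by move=> [? ? ? ?] [? ? ? ?] [? ? ? ?]; congr Quat => /=; ring. Qed.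
Lemma mulqDr : right_distributive mulq addq.
Proof. by move=> [? ? ? ?] [? ? ? ?] [? ? ? ?]; congr Quat => /=; ring. Qed.
Lemma quat1_neq0 : quat1 != quat0.
Proof. by apply/eqP => -[] /eqP; rewrite oner_eq0. Qed.

HB.instance Definition _ := GRing.Zmodule_isNzRing.Build (quat R)
  mulqA mul1q mulq1 mulqDl mulqDr quat1_neq0.

Lemma scaleqA a b x : scaleq a (scaleq b x) = scaleq (a * b) x.
Proof. by case: x => *; congr Quat; rewrite /= mulrA. Qed.
Lemma scale1q : left_id 1 scaleq.
Proof. by case=> *; congr Quat; rewrite /= mul1r. Qed.
Lemma scaleqDr : right_distributive scaleq +%R.
Proof. by move=> a [? ? ? ?] [? ? ? ?]; congr Quat; rewrite /= mulrDr. Qed.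
Lemma scaleqDl x : {morph scaleq^~ x : a b / a + b}.
Proof. by case: x => * a b; congr Quat; rewrite /= mulrDl. Qed.

HB.instance Definition _ := GRing.Zmodule_isLmodule.Build R (quat R)
  scaleqA scale1q scaleqDr scaleqDl.

Lemma scaleqAl a x y : scaleq a (x * y) = scaleq a x * y.
Proof. by case: x y => [? ? ? ?] [? ? ? ?]; congr Quat => /=; ring. Qed.
Lemma scaleqAr a x y : scaleq a (x * y) = x * scaleq a y.
Proof. by case: x y => [? ? ? ?] [? ? ? ?]; congr Quat => /=; ring. Qed.

HB.instance Definition _ := GRing.Lmodule_isLalgebra.Build R (quat R) scaleqAl.
HB.instance Definition _ := GRing.Lalgebra_isAlgebra.Build R (quat R) scaleqAr.

Lemma normq_eq0 x : (normq x == 0) = (x == 0).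
Proof.
apply/idP/eqP => [|->]; last by rewrite /normq /= !expr0n /= !addr0.
case: x => a b c d; rewrite /normq /= !paddr_eq0 ?addr_ge0 ?sqr_ge0 // !sqrf_eq0.
by move=> /andP[/andP[/andP[/eqP-> /eqP->] /eqP->] /eqP->].
Qed.

Definition unitq : pred (quat R) := fun x => x != 0.

Lemma mulVq : {in unitq, left_inverse 1 invq *%R}.
Proof.
move=> x; rewrite /in_mem /= /unitq -normq_eq0; case: x => a b c d.
by rewrite /normq /= => h; congr Quat; rewrite /= /normq /=; field.
Qed.
Lemma mulqV : {in unitq, right_inverse 1 invq *%R}.
Proof.
move=> x; rewrite /in_mem /= /unitq -normq_eq0; case: x => a b c d.
by rewrite /normq /= => h; congr Quat; rewrite /= /normq /=; field.
Qed.
Lemma unitqP x y : y * x = 1 /\ x * y = 1 -> unitq x.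
Proof.
by case=> yx1 _; apply/eqP => x0; move/eqP: yx1; rewrite x0 mulr0 eq_sym oner_eq0.
Qed.
Lemma invq_out : {in [predC unitq], invq =1 id}.
Proof.
move=> x; rewrite /in_mem /= negbK => /eqP ->.
by congr Quat; rewrite /= ?oppr0 mulr0.
Qed.

HB.instance Definition _ := GRing.NzRing_hasMulInverse.Build (quat R)
  mulVq mulqV unitqP invq_out.
End QuatRing.

(* DQuat p d is the dual quaternion p + eps d. *)
Record dquat (R : Type) := DQuat { primal : quat R; dual : quat R }.

Section DQuatChoice.
Variable R : choiceType.

Definition dquat_pair (x : dquat R) := (primal x, dual x).
Definition pair_dquat (t : quat R * quat R) := DQuat t.1 t.2.

Lemma dquat_pairK : cancel dquat_pair pair_dquat.
Proof. by case. Qed.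

HB.instance Definition _ := Choice.copy (dquat R) (can_type dquat_pairK).
End DQuatChoice.

Section DQuatRing.
Variable R : realFieldType.
Implicit Types x y z : dquat R.

Definition dquat0 : dquat R := DQuat 0 0.
Definition dquat1 : dquat R := DQuat 1 0.
Definition eps : dquat R := DQuat 0 1.
Definition adddq x y := DQuat (primal x + primal y) (dual x + dual y).
Definition oppdq x := DQuat (- primal x) (- dual x).
Definition scaledq (a : R) x := DQuat (a *: primal x) (a *: dual x).
Definition conjdq x := DQuat (conjq (primal x)) (conjq (dual x)).
Definition muldq x y :=
  DQuat (primal x * primal y) (primal x * dual y + dual x * primal y).

Lemma adddqA : associative adddq.
Proof. by move=> [? ?] [? ?] [? ?]; congr DQuat; rewrite /= addrA. Qed.
Lemma adddqC : commutative adddq.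
Proof. by move=> [? ?] [? ?]; congr DQuat; rewrite /= addrC. Qed.
Lemma add0dq : left_id dquat0 adddq.
Proof. by move=> [? ?]; congr DQuat; rewrite /= add0r. Qed.
Lemma addNdq : left_inverse dquat0 oppdq adddq.
Proof. by move=> [? ?]; congr DQuat; rewrite /= addNr. Qed.

HB.instance Definition _ :=
  GRing.isZmodule.Build (dquat R) adddqA adddqC add0dq addNdq.

Lemma muldqA : associative muldq.
Proof.
move=> [? ?] [? ?] [? ?]; congr DQuat; rewrite /= ?mulrA //.
by rewrite mulrDr mulrDl !mulrA addrA.
Qed.
Lemma mul1dq : left_id dquat1 muldq.
Proof. by move=> [? ?]; congr DQuat; rewrite /= ?mul0r ?mul1r ?addr0. Qed.
Lemma muldq1 : right_id dquat1 muldq.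
Proof. by move=> [? ?]; congr DQuat; rewrite /= ?mulr0 ?mulr1 ?add0r. Qed.
Lemma muldqDl : left_distributive muldq adddq.
Proof.
move=> [? ?] [? ?] [? ?]; congr DQuat; rewrite /= ?mulrDl //.
by rewrite -!addrA; congr (_ + _); rewrite addrCA.
Qed.
Lemma muldqDr : right_distributive muldq adddq.
Proof.
move=> [? ?] [? ?] [? ?]; congr DQuat; rewrite /= ?mulrDr //.
by rewrite -!addrA; congr (_ + _); rewrite addrCA.
Qed.
Lemma dquat1_neq0 : dquat1 != dquat0.
Proof. by apply/eqP => -[] /eqP; rewrite oner_eq0. Qed.

HB.instance Definition _ := GRing.Zmodule_isNzRing.Build (dquat R)
  muldqA mul1dq muldq1 muldqDl muldqDr dquat1_neq0.

Lemma scaledqA a b x : scaledq a (scaledq b x) = scaledq (a * b) x.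
Proof. by case: x => *; congr DQuat; rewrite /= scalerA. Qed.
Lemma scale1dq : left_id 1 scaledq.
Proof. by case=> *; congr DQuat; rewrite /= scale1r. Qed.
Lemma scaledqDr : right_distributive scaledq +%R.
Proof. by move=> a [? ?] [? ?]; congr DQuat; rewrite /= scalerDr. Qed.
Lemma scaledqDl x : {morph scaledq^~ x : a b / a + b}.
Proof. by case: x => * a b; congr DQuat; rewrite /= scalerDl. Qed.

HB.instance Definition _ := GRing.Zmodule_isLmodule.Build R (dquat R)
  scaledqA scale1dq scaledqDr scaledqDl.

Lemma scaledqAl a x y : scaledq a (x * y) = scaledq a x * y.
Proof. by case: x y => [? ?] [? ?]; congr DQuat; rewrite /= ?scalerDr !scalerAl. Qed.
Lemma scaledqAr a x y : scaledq a (x * y) = x * scaledq a y.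
Proof. by case: x y => [? ?] [? ?]; congr DQuat; rewrite /= ?scalerDr !scalerAr. Qed.

HB.instance Definition _ := GRing.Lmodule_isLalgebra.Build R (dquat R) scaledqAl.
HB.instance Definition _ := GRing.Lalgebra_isAlgebra.Build R (dquat R) scaledqAr.

Definition unitdq : pred (dquat R) := fun x => primal x \is a GRing.unit.
Definition invdq x :=
  if primal x \is a GRing.unit then
    DQuat (primal x)^-1 (- ((primal x)^-1 * dual x * (primal x)^-1))
  else x.

Lemma mulVdq : {in unitdq, left_inverse 1 invdq *%R}.
Proof.
move=> [p d]; rewrite /in_mem /= /unitdq /invdq /= => up; rewrite up.
by congr DQuat; rewrite /= ?mulVr // mulNr mulrVK // subrr.
Qed.
Lemma muldqV : {in unitdq, right_inverse 1 invdq *%R}.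
Proof.
move=> [p d]; rewrite /in_mem /= /unitdq /invdq /= => up; rewrite up.
by congr DQuat; rewrite /= ?mulrV // mulrN !mulrA mulrV // mul1r addNr.
Qed.
Lemma unitdqP x y : y * x = 1 /\ x * y = 1 -> unitdq x.
Proof.
case=> /(congr1 (@primal R)) h1 /(congr1 (@primal R)) h2.
by apply/unitrP; exists (primal y).
Qed.
Lemma invdq_out : {in [predC unitdq], invdq =1 id}.
Proof. by move=> x; rewrite /in_mem /= /unitdq /invdq => /negPf ->. Qed.

HB.instance Definition _ := GRing.NzRing_hasMulInverse.Build (dquat R)
  mulVdq muldqV unitdqP invdq_out.
End DQuatRing.

Section RealDivisors.
Variables (R : realType) (V : lalgType R).
Implicit Types (A B : {poly V}) (F G : {poly R}).

Definition realp F : {poly V} := map_poly (in_alg V) F.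

Definition rdivides F A : Prop := exists K : {poly V}, A = realp F * K.

Definition is_mrpf A B F : Prop :=
  [/\ F \is monic, rdivides F A, rdivides F B &
      forall G, rdivides G A -> rdivides G B -> G %| F].

(* The default value 1 is only taken for A = B = 0. *)
Definition mrpf A B : {poly R} := xget 1 [set F | is_mrpf A B F]%classic.

(* The exact quotient A / F, None if it does not exist. *)
Definition realquo A F : option {poly V} :=
  if `[< F != 0 /\ rdivides F A >]
  then Some (xget 0 [set K : {poly V} | A = realp F * K]%classic)
  else None.

(* The remainder by F is that by the monic associate of F, for which rmodp is a
   genuine remainder. *)
Definition realrem A F : {poly V} := rmodp A (realp ((lead_coef F)^-1 *: F)).
End RealDivisors.

Arguments realp {R V} F.

Section MotionPolynomials.
Variable R : realType.
Local Notation H := (quat R).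
Local Notation DH := (dquat R).
Implicit Types (A B P D Q : {poly H}) (M : {poly DH}) (F : {poly R}).

Definition conjqp A : {poly H} := map_poly (@conjq R) A.
Definition conjdp M : {poly DH} := map_poly (@conjdq R) M.
Definition nuq A : {poly H} := A * conjqp A.
Definition nu M : {poly DH} := M * conjdp M.

Definition of_primal A : {poly DH} := map_poly (fun q : H => DQuat q 0) A.

(* P + eps D *)
Definition dualp P D : {poly DH} := of_primal P + (eps R)%:P * of_primal D.
Definition primalp M : {poly H} := map_poly (@primal R) M.

Definition motion M : Prop := exists2 F, F != 0 & nu M = realp F.

Definition reduced M : Prop := mrpf M M = 1.

Definition generic M : Prop :=
  [/\ M \is monic, motion M, reduced M & mrpf (primalp M) (primalp M) = 1].

Definition bounded M : Prop :=
  [/\ M \is monic, motion M, reduced M &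
      forall x : R, ~~ root (mrpf (primalp M) (primalp M)) x].

Definition ldivides G A : Prop := exists K : {poly H}, A = G * K.

Definition is_lgcd A B (G : {poly H}) : Prop :=
  [/\ G \is monic, ldivides G A, ldivides G B &
      forall G', ldivides G' A -> ldivides G' B -> (size G' <= size G)%N].

(* is_lgcd A B determines G as soon as A and B are not both zero. *)
Definition lgcd A B : {poly H} := xget 0 [set G | is_lgcd A B G]%classic.

(* F is an irreducible quadratic real factor of nu M. *)
Definition quadratic_factor M F : Prop :=
  [/\ irreducible_poly F, size F = 3%N & rdivides F (nu M)].

(* The two choices left open by the procedures are made by oracles.  They may
   depend on the current argument, so that quantifying over all valid oracles
   quantifies over all possible runs. *)
Definition valid_chF (chF : {poly DH} -> {poly R}) : Prop :=
  forall M, (exists F, quadratic_factor M F) -> quadratic_factor M (chF M).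

Definition valid_chq (chq : H -> H) : Prop :=
  forall p : H, (exists q, q * p <> p * q) -> chq p * p <> p * chq p.

(* Both procedures return None when a step cannot be carried out: no admissible
   choice, an inverse or an exact quotient that does not exist. *)
Section Procedures.
Variables (chF : {poly DH} -> {poly R}) (chq : H -> H).

(* rdivp A B is the left quotient: A = rdivp A B * B + rmodp A B for monic B.
   Each call lowers the degree by one, so that deg M is enough fuel. *)
Fixpoint gfactor_rec (k : nat) M : option (seq {poly DH}) :=
  if size M == 1%N then Some [::] else
  if k is k'.+1 then
    let F := chF M in
    let r := realrem M F in
    let h := - (r`_1)^-1 * r`_0 in
    if `[< quadratic_factor M F >] && (r`_1 \is a GRing.unit) then
      omap (fun s => rcons s ('X - h%:P))
           (gfactor_rec k' (rdivp M ('X - h%:P)))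
    else None
  else None.

Definition gfactor M : option (seq {poly DH}) := gfactor_rec (size M).-1 M.

(* Step 2: the pair (Q_L, D_L). *)
Definition factor3_left (N g : {poly R}) Q D : option ({poly H} * {poly H}) :=
  let QL := lgcd (realp g) Q in
  obind (fun S =>
    if `[< rdivides N S >] then
      let p := - (lgcd (realp N) Q)`_0 in
      let q := chq p in
      if (lgcd (realp N) Q == 'X - p%:P) && (q * p != p * q)
      then Some (QL, q%:P * QL - QL * q%:P)
      else None
    else Some (QL, 0)) (realquo (conjqp Q * D) g).

(* Steps 3 to 6. *)
Definition factor3_right (c g : {poly R}) Q D QL DL :
    option ({poly DH} * {poly DH} * {poly DH}) :=
  obind (fun DR => obind (fun QR =>
    let Qc := lgcd (realp c) DR in
    obind (fun Dr =>
      let Mr := dualp (conjqp Qc * QR) Dr in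
      omap (fun L : seq {poly DH} =>
        let m := (size c).-1./2 in
        (dualp QL DL,
         of_primal Qc * \prod_(l <- take m L) l,
         \prod_(l <- drop m L) l)) (gfactor Mr))
      (realquo (conjqp Qc * DR) c))
    (realquo (conjqp QL * Q) g))
    (realquo (realp c * conjqp DL * Q + conjqp QL * D) g).

(* The input is M = c Q + eps D. *)
Definition factor3 (N c g : {poly R}) Q D :
    option ({poly DH} * {poly DH} * {poly DH}) :=
  if size Q == 1%N then Some (1, dualp (realp c * Q) D, 1)
  else obind (fun LD => factor3_right c g Q D LD.1 LD.2)
             (factor3_left N g Q D).
End Procedures.
End MotionPolynomials.

(* Main.v *)
Require Import Defs.
From HB Require Import structures.
From mathcomp Require Import all_boot all_order all_algebra.
From mathcomp Require Import ring lra zify.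
From mathcomp Require Import boolp classical_sets reals.

Set Implicit Arguments.
Unset Strict Implicit.
Unset Printing Implicit Defensive.

Import Order.TTheory GRing.Theory Num.Theory Pdiv.Ring.
Local Open Scope ring_scope.

(** Only one prime is involved: c = N^m, g = N^k with k <= m, and Q has norm
    N^e, where N is taken monic. Maximality of c and reducedness of M say that N
    divides neither Q nor D; such polynomials are called primitive below.

    The engine is that H[t] is a principal ideal domain on either side. If A is
    primitive and N^k divides its norm, the monic generator G of the right ideal
    of N^k and A has norm exactly N^k, and it is the only monic left divisor of
    A of this norm (left_factor_exists_bezout, left_factor_uniq); so it is the
    left gcd of N^k and A. If moreover N^k divides the product of the conjugate
    of some B with A, then G divides B on the left, too (left_factor_transport).

    Applied to Q and D this gives Q = QL Q1 and D = QL D1 with QL of norm g. For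
    every quaternion q the commutator DL of q and QL makes ML = QL + eps DL a
    motion polynomial, and ML splits off from M on the left with cofactor
    c Q1 + eps DR. Because N divides c, DR is primitive. The hypotheses on
    the product of D with the conjugate of Q and on the norm of D make c divide
    the norm of DR (left_cofactor_norm). So the left gcd Qc of c and DR has norm c
    and splits off from the cofactor; what remains is
    Mr = conj(Qc) Q1 + eps D2.

    The point of q is that Mr is generic, which holds as soon as N does not
    divide conj(Q1) DR. With q = 0 this product is conj(Q1) D1, which is
    conj(Q) D / g. If N divides it, then maximality of g forces g = c, and
    modulo N the product becomes conj(Q) conj(q) Q. That N divides the latter
    would mean that Q and q Q share their first linear factor t - p, that is,
    q p = p q (noncommuting_conjugate_primitive).

    A generic motion polynomial whose norm is a power of N factors into
    linear motion polynomials of norm N (gfactor_norm). The product of the first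
    m factors of Mr has primal part conj(Qc), again by uniqueness of left factors,
    so the product of Qc with it has primal part c (right_split). All factors
    are generic because their primal parts divide primitive polynomials. For
    Q = 1 only this last splitting occurs. *)

(** * Real divisors *)

Section RealDivisorTheory.
Variables (R : realType) (V : lalgType R).
Implicit Types (A B : {poly V}) (F G : {poly R}).

HB.instance Definition _ :=
  GRing.RMorphism.copy (@realp R V) (map_poly (in_alg V)).

Lemma realpM F G : realp (F * G) = realp F * realp G :> {poly V}.
Proof. exact: rmorphM. Qed.

Lemma realp_monic F : (realp F : {poly V}) \is monic = (F \is monic).
Proof. exact: map_monic. Qed.

Lemma size_realp F : size (realp F : {poly V}) = size F.
Proof. exact: size_map_poly. Qed.

Lemma realp_inj : injective (@realp R V).
Proof. exact: map_poly_inj. Qed.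

Lemma realp_lreg F : F != 0 -> GRing.lreg (realp F : {poly V}).
Proof.
move=> F0; apply: lreg_lead; rewrite lead_coef_map /= => x y.
by rewrite !mulr_algl; apply: scalerI; rewrite lead_coef_eq0.
Qed.

Lemma size_realpM F A :
  F != 0 -> A != 0 -> size (realp F * A) = (size F + size A).-1.
Proof.
move=> F0 A0; rewrite size_proper_mul ?size_realp // lead_coef_map /= mulr_algl.
by rewrite scaler_eq0 !lead_coef_eq0 negb_or F0.
Qed.

(** If realp G = realp F * K, the remainder of G by F equals realp F times the
    difference of K and the real quotient; its degree forces it to vanish. *)
Lemma rdivides_realp F G : rdivides F (realp G : {poly V}) <-> F %| G.
Proof.
split=> [[K eK]|/dvdpP[q ->]]; last by exists (realp q); rewrite mulrC rmorphM.
have [F0|F0] := eqVneq F 0.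
  by move: eK; rewrite F0 rmorph0 mul0r -(rmorph0 (@realp R V)) => /realp_inj->.
have e : realp (G %% F) = realp F * (K - realp (G %/ F)) :> {poly V}.
  by rewrite mulrBr -eK {2}(divp_eq G F) rmorphD [_ * F]mulrC rmorphM addrAC subrr add0r.
rewrite /dvdp -size_poly_eq0; case: (eqVneq (K - realp (G %/ F)) 0) => [K0|K0].
  by rewrite -(size_realp (G %% F)) e K0 mulr0 size_poly0.
have : (size (G %% F)%R < size F)%N by rewrite ltn_modpN0.
rewrite -(size_realp (G %% F)) e size_realpM // (polySpred K0) addnS /=.
by rewrite ltnNge leq_addr.
Qed.

Lemma rdivides_trans F G A : F %| G -> rdivides G A -> rdivides F A.
Proof.
by move=> /dvdpP[q ->] [K ->]; exists (realp q * K); rewrite mulrA -rmorphM mulrC.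
Qed.

Lemma rdivides0 F : rdivides F (0 : {poly V}).
Proof. by exists 0; rewrite mulr0. Qed.

Lemma rdivides_mull F A : rdivides F (realp F * A).
Proof. by exists A. Qed.

Lemma rdivides_self F : rdivides F (realp F : {poly V}).
Proof. by exists 1; rewrite mulr1. Qed.

Lemma rdividesMr F A B : rdivides F A -> rdivides F (A * B).
Proof. by case=> K ->; exists (K * B); rewrite mulrA. Qed.

Lemma rdividesD F A B : rdivides F A -> rdivides F B -> rdivides F (A + B).
Proof. by case=> K -> [L ->]; exists (K + L); rewrite mulrDr. Qed.

Lemma rdividesN F A : rdivides F A -> rdivides F (- A).
Proof. by case=> K ->; exists (- K); rewrite mulrN. Qed.

Lemma rdividesB F A B : rdivides F A -> rdivides F B -> rdivides F (A - B).
Proof. by move=> FA FB; apply/rdividesD/rdividesN. Qed.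

Lemma rdivides_cancel F G A :
  F != 0 -> rdivides (F * G) (realp F * A) -> rdivides G A.
Proof.
by move=> F0 [K]; rewrite rmorphM -mulrA => /(realp_lreg F0) ->; exists K.
Qed.

Lemma rdivides_mul2l F G A : rdivides G A -> rdivides (F * G) (realp F * A).
Proof. by case=> K ->; exists K; rewrite mulrA -realpM. Qed.

Lemma rdividesZ F A (a : R) : a != 0 -> rdivides F A -> rdivides (a *: F) A.
Proof. by move=> a0; apply: rdivides_trans; rewrite dvdpZl. Qed.

(** With d the gcd, F / d and G / d are coprime, and their Bezout coefficients
    combine the cofactors X and Y of A to that of the least common multiple. *)
Lemma rdivides_lcm F G A : F != 0 -> G != 0 ->
  rdivides F A -> rdivides G A -> rdivides (F * (G %/ gcdp F G)) A.
Proof.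
move=> F0 G0 [X eX] [Y eY]; set d := gcdp F G.
have d0 : d != 0 by rewrite gcdp_eq0 negb_and F0.
have eF : F = d * (F %/ d) by rewrite mulrC divpK ?dvdp_gcdl.
have eG : G = d * (G %/ d) by rewrite mulrC divpK ?dvdp_gcdr.
have /Bezout_eq1_coprimepP[[u v] /= uv] : coprimep (F %/ d) (G %/ d).
  by apply: coprimep_div_gcd; rewrite F0.
have fXgY : realp (F %/ d) * X = realp (G %/ d) * Y.
  by apply: (realp_lreg d0); rewrite !mulrA -!rmorphM -eF -eG -eX -eY.
exists (realp u * Y + realp v * X).
rewrite rmorphM -mulrA {1}eX; congr (_ * _).
rewrite mulrDr -[X in X = _]mul1r -(rmorph1 (@realp R V)) -uv rmorphD mulrDl.
congr (_ + _); last by rewrite mulrA -rmorphM [v * _]mulrC.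
by rewrite rmorphM -mulrA fXgY mulrA -rmorphM mulrC rmorphM -mulrA mulrA -rmorphM.
Qed.

(** The degrees of the real divisors are bounded only because A is nonzero; one
    of maximal degree absorbs every other one by rdivides_lcm. *)
Lemma mrpfP A B : A != 0 -> is_mrpf A B (mrpf A B).
Proof.
move=> A0; apply: (@xgetPex _ 1).
pose P s := `[< exists F, [/\ F \is monic, rdivides F A, rdivides F B & size F = s] >].
have exP : exists s, P s.
  exists (size (1 : {poly R})); apply/asboolP; exists 1; split=> //.
  - exact: monic1.
  - by exists A; rewrite rmorph1 mul1r.
  - by exists B; rewrite rmorph1 mul1r.
have ubP s : P s -> (s <= size A)%N.
  move=> /asboolP[F [Fm [K eK] _ <-]].
  have K0 : K != 0 by apply: contraNneq A0 => K0; rewrite eK K0 mulr0.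
  by rewrite eK (size_realpM (monic_neq0 Fm) K0) (polySpred K0) addnS leq_addr.
have [s /asboolP[F [Fm FA FB sF]] max] := ex_maxnP exP ubP.
exists F; split=> // G GA GB.
have F0 := monic_neq0 Fm.
have G0 : G != 0.
  by apply: contraNneq A0 => G0; case: GA => K ->; rewrite G0 rmorph0 mul0r.
set H := G %/ gcdp F G.
have H0 : H != 0 by rewrite divpN0 ?leq_gcdpr // gcdp_eq0 negb_and F0.
have l0 : (lead_coef H)^-1 != 0 by rewrite invr_neq0 // lead_coef_eq0.
pose H1 : {poly R} := (lead_coef H)^-1 *: H.
have H1m : H1 \is monic by rewrite monicE lead_coefZ mulVf // -invr_eq0.
have FH1 (X : {poly V}) : rdivides F X -> rdivides G X -> rdivides (F * H1) X.
  move=> FX GX; have -> : F * H1 = (lead_coef H)^-1 *: (F * H) by rewrite scalerAr.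
  by apply: rdividesZ l0 _; apply: rdivides_lcm.
have FH1m : F * H1 \is monic by rewrite monicMl.
have PFH1 : P (size (F * H1)%R).
  by apply/asboolP; exists (F * H1); split=> //; apply: FH1.
have := max _ PFH1.
rewrite -sF (size_monicM Fm (monic_neq0 H1m)) (size_scale _ l0) => sH.
have : size H == 1%N.
  move: sH; rewrite (polySpred F0) (polySpred H0) addnS /= -[leqRHS]addn0 leq_add2l.
  by case: (_.-1).
move=> /size_poly1P[h h0 eH]; have -> : G = h *: gcdp F G.
  by rewrite -[LHS](divpK (dvdp_gcdr F G)) -/H eH mul_polyC.
by rewrite dvdpZl // dvdp_gcdl.
Qed.

(** The default value of the choice operator is also 1, so that existence of a
    greatest real divisor is not an issue. *)
Lemma mrpf_eq1 A B :
  (forall F, F \is monic -> rdivides F A -> F = 1) -> mrpf A B = 1.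
Proof. by move=> h; rewrite /mrpf; case: xgetP => // F _ [Fm FA _ _]; apply: h. Qed.

Lemma realquoE A F K : F != 0 -> A = realp F * K -> realquo A F = Some K.
Proof.
move=> F0 eA; rewrite /realquo asboolT; last by split=> //; exists K.
congr Some; apply: xget_unique => //= L.
by rewrite eA => /(realp_lreg F0).
Qed.

End RealDivisorTheory.

Section CentralRealDivisors.
Variables (R : realType) (V : algType R).
Implicit Types (A B : {poly V}) (F G : {poly R}).

Lemma realp_comm F A : A * realp F = realp F * A.
Proof.
apply/polyP => i; rewrite coefM coefMr; apply: eq_bigr => j _.
by rewrite !coef_map /= mulr_algl mulr_algr.
Qed.

Lemma rdividesMl F A B : rdivides F B -> rdivides F (A * B).
Proof. by case=> K ->; exists (A * K); rewrite mulrA realp_comm mulrA. Qed.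

(** Units are given by an inverse because an algebra need not have a unit
    structure. *)
Lemma rdivides_unitl F A (u v : V) :
  v * u = 1 -> rdivides F (u%:P * A) -> rdivides F A.
Proof.
by move=> vu /(rdividesMl v%:P); rewrite mulrA -polyCM vu mul1r.
Qed.

End CentralRealDivisors.

Lemma dvdp_irr_exp (K : fieldType) (N F : {poly K}) n :
  irreducible_poly N -> N \is monic -> F \is monic -> F %| N ^+ n ->
  exists2 j, (j <= n)%N & F = N ^+ j.
Proof.
move=> Nirr Nm; elim: n F => [|n IHn] F Fm.
  rewrite expr0 dvdp1 => /size_poly1P[a _ eF]; exists 0%N => //.
  by move/monicP: Fm; rewrite eF lead_coefC => ->.
have [NF|] := boolP (coprimep F N).
  by rewrite exprS Gauss_dvdpr // => /(IHn _ Fm)[j jn ->]; exists j; rewrite // leqW.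
rewrite coprimep_sym => szg.
have NF : N %| F.
  by rewrite -(eqp_dvdl _ (Nirr _ szg (dvdp_gcdl _ _))) dvdp_gcdr.
move: NF Fm => /dvdpP[G ->]; rewrite monicMr // => Gm.
rewrite exprSr dvdp_mul2r ?monic_neq0 // => /(IHn _ Gm)[j jn ->].
by exists j.+1; rewrite // exprSr.
Qed.

(** * Conjugation and norm *)

(** The conjugations of quaternion and of dual quaternion polynomials are
    treated at once as a degree preserving antiautomorphism cj. Norms of dual
    quaternion polynomials need not be real. *)
Section Norm.
Variables (R : realType) (V : algType R) (cj : {poly V} -> {poly V}).
Hypothesis cjM : forall A B, cj (A * B) = cj B * cj A.
Hypothesis cj_monic : forall A, A \is monic -> cj A \is monic.
Hypothesis size_cj : forall A, size (cj A) = size A.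
Implicit Types (A B : {poly V}) (F G : {poly R}).
Local Notation nrm A := (A * cj A).

Lemma norm_mul A B F : nrm B = realp F -> nrm (A * B) = realp F * nrm A.
Proof. by move=> eB; rewrite cjM mulrA -(mulrA A) eB realp_comm mulrA. Qed.

(** A is regular and A * (cj A * A) = (A * cj A) * A, where the right-hand side
    is A times the real norm. *)
Lemma norm_comm A F : A \is monic -> nrm A = realp F -> cj A * A = realp F.
Proof.
by move=> Am eA; apply: (monic_lreg Am); rewrite mulrA eA realp_comm.
Qed.

Lemma norm_monic A : A \is monic -> nrm A \is monic.
Proof. by move=> Am; rewrite monicMl // cj_monic. Qed.

Lemma size_norm A : A \is monic -> size (nrm A) = (size A + size A).-1.
Proof. by move=> Am; rewrite size_monicM ?size_cj // monic_neq0 // cj_monic. Qed.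

(** The norm of A * B is A * nrm B * cj A, and both outer factors are regular. *)
Lemma norm_cancel_l A B F G : A \is monic -> nrm A = realp F ->
  nrm (A * B) = realp (F * G) -> nrm B = realp G.
Proof.
move=> Am eA; rewrite cjM mulrA -(mulrA A) mulrC => e.
apply: (monic_lreg Am); apply: (monic_rreg (cj_monic Am)).
by rewrite /= e (realp_comm G A) -mulrA eA -rmorphM.
Qed.

Lemma norm_cancel_r A B F G : F != 0 -> nrm B = realp F ->
  nrm (A * B) = realp (F * G) -> nrm A = realp G.
Proof. by move=> F0 eB; rewrite (norm_mul A eB) rmorphM => /(realp_lreg F0). Qed.

Lemma norm_exp_size A (N : {poly R}) d : N \is monic -> size N = 3%N ->
  A \is monic -> nrm A = realp (N ^+ d) -> size A = d.+1.
Proof.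
move=> Nm sN Am /(congr1 (fun X : {poly V} => (size X).-1)).
rewrite size_norm // size_realp size_exp sN.
have : (0 < size A)%N by rewrite size_poly_gt0 monic_neq0.
by case: (size A) => // s _; rewrite addSn addnS /=; lia.
Qed.
End Norm.

Lemma map_poly_anti (V : nzRingType) (f : {additive V -> V}) :
  (forall x y, f (x * y) = f y * f x) ->
  forall A B, map_poly f (A * B) = map_poly f B * map_poly f A.
Proof.
move=> fM A B; apply/polyP => i.
rewrite coef_map coefMr coefM raddf_sum; apply: eq_bigr => j _.
by rewrite fM !coef_map.
Qed.

Section QuaternionPolynomials.
Variable R : realType.
Local Notation H := (quat R).
Implicit Types (A B C : {poly H}) (F G : {poly R}).

Lemma conjq_zmod : zmod_morphism (@conjq R).
Proof. by move=> [? ? ? ?] [? ? ? ?]; congr Quat => /=; ring. Qed.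
HB.instance Definition _ := GRing.isZmodMorphism.Build H H (@conjq R) conjq_zmod.

Lemma conjqM (x y : H) : conjq (x * y) = conjq y * conjq x.
Proof. by case: x y => [? ? ? ?] [? ? ? ?]; congr Quat => /=; ring. Qed.

Lemma conjqK : involutive (@conjq R).
Proof. by move=> [? ? ? ?]; rewrite /conjq /= !opprK. Qed.

Lemma conjq_alg (a : R) : conjq (a *: (1 : H)) = a *: 1.
Proof. by congr Quat; rewrite /= mulr0 oppr0. Qed.

HB.instance Definition _ := GRing.Additive.copy (@conjqp R) (map_poly (@conjq R)).

Lemma conjqpM A B : conjqp (A * B) = conjqp B * conjqp A.
Proof. exact: map_poly_anti conjqM A B. Qed.

Lemma conjqpD A B : conjqp (A + B) = conjqp A + conjqp B.
Proof. exact: raddfD. Qed.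

Lemma conjqpB A B : conjqp (A - B) = conjqp A - conjqp B.
Proof. exact: raddfB. Qed.

Lemma coef_conjqp A i : (conjqp A)`_i = conjq A`_i.
Proof. exact: coef_map. Qed.

Lemma conjqpK : involutive (@conjqp R).
Proof. by move=> A; apply/polyP => i; rewrite !coef_conjqp conjqK. Qed.

Lemma conjqp_real F : conjqp (realp F) = realp F.
Proof. by apply/polyP => i; rewrite coef_conjqp !coef_map /= conjq_alg. Qed.

Lemma conjqpC (a : H) : conjqp a%:P = (conjq a)%:P.
Proof. exact: map_polyC. Qed.

Lemma size_conjqp A : size (conjqp A) = size A.
Proof. exact: size_map_inj_poly (inv_inj conjqK) (raddf0 (@conjq R)) A. Qed.

Lemma conjqp_monic A : A \is monic -> conjqp A \is monic.
Proof.
move=> /monicP; rewrite monicE !lead_coefE size_conjqp coef_conjqp => ->.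
by rewrite -[1]scale1r conjq_alg.
Qed.

Lemma conjqp_eq0 A : (conjqp A == 0) = (A == 0).
Proof. by rewrite -!size_poly_eq0 size_conjqp. Qed.

Lemma rdivides_conj F A : rdivides F A -> rdivides F (conjqp A).
Proof.
by case=> K ->; exists (conjqp K); rewrite conjqpM conjqp_real realp_comm.
Qed.

Lemma conj_invariant_real A : conjqp A = A -> exists F, A = realp F.
Proof.
move=> eA; exists (map_poly (@qre R) A); apply/polyP => i.
have : conjq A`_i = A`_i by rewrite -coef_conjqp eA.
rewrite coef_map /= coef_map_id0 //; case: (A`_i) => a b c d [] /= hb hc hd.
by congr Quat => /=; lra.
Qed.

Lemma nuq_real A : exists F, nuq A = realp F.
Proof. by apply: conj_invariant_real; rewrite /nuq conjqpM conjqpK. Qed.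

(** Traces of polynomials are real; this is what makes the mixed terms in the
    norm computations below divisible by powers of N. *)
Lemma trace_real A : exists F, A + conjqp A = realp F.
Proof. by apply: conj_invariant_real; rewrite conjqpD conjqpK addrC. Qed.

Lemma quat_unit (x : H) : (x \is a GRing.unit) = (x != 0).
Proof. by []. Qed.

Lemma quat_lreg (x : H) : x != 0 -> GRing.lreg x.
Proof. by move=> x0; apply: mulrI; rewrite quat_unit. Qed.

Lemma hpoly_lreg A : A != 0 -> GRing.lreg A.
Proof. by move=> A0; apply/lreg_lead/quat_lreg; rewrite lead_coef_eq0. Qed.

Lemma hpoly_mul_eq0 A B : (A * B == 0) = (A == 0) || (B == 0).
Proof.
have [->|A0] := eqVneq A 0; first by rewrite mul0r eqxx.
by rewrite (mulrI_eq0 _ (hpoly_lreg A0)).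
Qed.

Lemma size_hpolyM A B : A != 0 -> B != 0 -> size (A * B) = (size A + size B).-1.
Proof.
move=> A0 B0; rewrite size_proper_mul //.
by rewrite (mulrI_eq0 _ (quat_lreg _)) lead_coef_eq0.
Qed.

Lemma nuqM A B : nuq (A * B) = nuq A * nuq B.
Proof.
have [F eB] := nuq_real B; rewrite {1}/nuq (norm_mul (cj := @conjqp R) conjqpM A eB).
by rewrite -realp_comm -eB.
Qed.

Lemma nuq_conj A : nuq (conjqp A) = nuq A.
Proof.
have [->|A0] := eqVneq A 0; first by rewrite raddf0.
have [F eA] := nuq_real A; apply: (hpoly_lreg A0).
rewrite /nuq conjqpK mulrA -/(nuq A) eA; exact/esym/realp_comm.
Qed.

Lemma conj_mul_nuq A : conjqp A * A = nuq A.
Proof. by rewrite -nuq_conj /nuq conjqpK. Qed.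

Lemma nuq1 : nuq (1 : {poly H}) = realp 1.
Proof. by rewrite /nuq mul1r -[1](rmorph1 (@realp R H)) conjqp_real. Qed.

Lemma nuqC (a : H) : nuq a%:P = realp (Defs.normq a)%:P.
Proof.
rewrite /nuq conjqpC -polyCM; apply/polyP => i.
rewrite coef_map !coefC /=; case: (i == 0%N); last by rewrite scale0r.
by case: a => *; congr Quat; rewrite /= /Defs.normq /=; ring.
Qed.

Lemma nuq_realp F : nuq (realp F) = realp (F ^+ 2).
Proof. by rewrite /nuq conjqp_real -rmorphM. Qed.

(** The mixed terms of the norm of a difference form a trace. *)
Lemma nuqB A B :
  nuq (A - B) = nuq A - (A * conjqp B + conjqp (A * conjqp B)) + nuq B.
Proof.
rewrite /nuq conjqpB mulrBl !mulrBr conjqpM conjqpK opprB opprD !addrA.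
exact: addrAC.
Qed.

End QuaternionPolynomials.

(** * Left factors of quaternion polynomials *)

Lemma monic_size1 (V : nzRingType) (A : {poly V}) : A \is monic -> size A = 1%N -> A = 1.
Proof.
move=> /monicP Am /eqP/size_poly1P[a _ eA].
by move: Am; rewrite eA lead_coefC => ->.
Qed.

Section LeftBezout.
Variable V : unitRingType.
Hypothesis V_division : forall x : V, x != 0 -> x \is a GRing.unit.
Implicit Types A B : {poly V}.

Let V_lreg (x : V) : x != 0 -> GRing.lreg x.
Proof. by move=> /V_division; apply: mulrI. Qed.

(** Euclid's algorithm. The divisor is made monic before each division, which
    changes neither the left ideal nor the degrees. *)
Lemma left_bezout A B : (A != 0) || (B != 0) ->
  exists G S T A1 B1 : {poly V}, [/\ G \is monic, G = S * A + T * B, A = A1 * G & B = B1 * G].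
Proof.
have normalize (C : {poly V}) : C != 0 -> exists a b : V,
    [/\ a * b = 1, b%:P * C \is monic & size (b%:P * C) = size C].
  move=> C0; have l0 : lead_coef C != 0 by rewrite lead_coef_eq0.
  have lu : lead_coef C \is a GRing.unit by exact: V_division.
  have i0 : (lead_coef C)^-1 != 0 by rewrite invr_eq0.
  exists (lead_coef C), (lead_coef C)^-1; split.
  - by rewrite mulrV.
  - by rewrite monicE mul_polyC lead_coef_lreg ?mulVr //; apply: V_lreg.
  - by rewrite mul_polyC lreg_size //; apply: V_lreg.
elim: {B}(size B).+1 {-2}B (ltnSn (size B)) A => // s IHs B sB A.
have [-> A0|B0 _] := eqVneq B 0.
  have /normalize[a [b [ab bm _]]] : A != 0 by move: A0; rewrite orbF.
  exists (b%:P * A), b%:P, 0, a%:P, 0; split.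
  - exact: bm.
  - by rewrite mul0r addr0.
  - by rewrite mulrA -polyCM ab mul1r.
  - by rewrite mul0r.
have [a [b [ab bm sb]]] := normalize B B0; set B0' := b%:P * B in bm sb.
have eA := Pdiv.RingMonic.rdivp_eq bm A.
have sr : (size (rmodp A B0') < s)%N.
  by apply: leq_trans (_ : size B <= s)%N; rewrite // -sb ltn_rmodp monic_neq0.
have /(IHs _ sr)[G [S [T [A1 [B1 [Gm eG eB er]]]]]] : (B0' != 0) || (rmodp A B0' != 0).
  by rewrite (monic_neq0 bm).
exists G, T, ((S - T * rdivp A B0') * b%:P), (rdivp A B0' * A1 + B1), (a%:P * A1).
split.
- exact: Gm.
- have er' : rmodp A B0' = A - rdivp A B0' * B0' by rewrite {2}eA addrC addKr.
  rewrite -mulrA -/B0' eG er' mulrBr mulrBl mulrA.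
  by rewrite addrCA -!mulrA.
- by rewrite mulrDl -mulrA -eB -er.
- by rewrite -mulrA -eB mulrA -polyCM ab mul1r.
Qed.

End LeftBezout.

Section LeftFactors.
Variables (R : realType).
Local Notation H := (quat R).
Implicit Types (A B D G Q : {poly H}).

(** Conjugation exchanges left and right ideals. *)
Lemma right_bezout A B : (A != 0) || (B != 0) ->
  exists G U V A1 B1 : {poly H}, [/\ G \is monic, G = A * U + B * V, A = G * A1 & B = G * B1].
Proof.
rewrite -(conjqp_eq0 A) -(conjqp_eq0 B) => AB.
have [x|G [U [V [A1 [B1 [Gm eG eA eB]]]]]] := left_bezout _ AB; first by rewrite quat_unit.
exists (conjqp G), (conjqp U), (conjqp V), (conjqp A1), (conjqp B1); split.
- exact: conjqp_monic.
- by rewrite eG conjqpD !conjqpM !conjqpK.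
- by rewrite -conjqpM -eA conjqpK.
- by rewrite -conjqpM -eB conjqpK.
Qed.

Variable N : {poly R}.
Hypotheses (Nirr : irreducible_poly N) (Nm : N \is monic) (sN : size N = 3%N).

(** G plays the part of the product of the first k linear factors of A; this form
    avoids factoring A. *)
Definition left_factor k A G :=
  [/\ G \is monic, nuq G = realp (N ^+ k) & ldivides G A].

Lemma Nexp_neq0 k : N ^+ k != 0.
Proof. by rewrite expf_neq0 // monic_neq0. Qed.

Lemma dvdp_Nexp i j : (N ^+ i %| N ^+ j) = (i <= j)%N.
Proof. by rewrite dvdp_Pexp2l // sN. Qed.

Lemma Nexp_inj : injective (fun k => N ^+ k).
Proof.
by move=> i j /= e; apply/eqP; rewrite eqn_leq -!dvdp_Nexp e dvdpp.
Qed.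

Lemma nuq_size A d : A \is monic -> nuq A = realp (N ^+ d) -> size A = d.+1.
Proof.
exact: (norm_exp_size (@conjqp_monic R) (@size_conjqp R) Nm sN).
Qed.

(** Let G be the monic generator of the right ideal of N^k and D. Its norm
    divides a power of N, hence is N^j for some j. Expanding the norm of
    N^k * U + D * V shows k <= j. As G is a left divisor of N^k, a larger j
    would make N divide the conjugate of G, hence G and D. *)
Lemma left_factor_exists_bezout k D :
  ~ rdivides N D -> rdivides (N ^+ k) (nuq D) ->
  exists G U V : {poly H}, left_factor k D G /\ G = realp (N ^+ k) * U + D * V.
Proof.
move=> ND NkD; have Nk0 : (realp (N ^+ k) : {poly H}) != 0.
  by rewrite monic_neq0 // realp_monic monic_exp.
have [|G [U [V [K [D1 [Gm eG eK eD]]]]]] := @right_bezout (realp (N ^+ k)) D.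
  by rewrite Nk0.
exists G, U, V; split; last exact: eG.
split; [exact: Gm | | by exists D1].
have [F eF] := nuq_real G; have [F' eF'] := nuq_real K.
have Fm : F \is monic.
  by rewrite -(realp_monic H) -eF (norm_monic (@conjqp_monic R)).
have [|j _ eFj] := @dvdp_irr_exp R N F (k * 2) Nirr Nm Fm.
  apply/dvdpP; exists F'; apply: (@realp_inj R H).
  by rewrite exprM -nuq_realp eK nuqM eF eF' mulrC realpM.
rewrite eF eFj; congr (realp (N ^+ _)); apply/eqP; rewrite eqn_leq; apply/andP; split.
  rewrite leqNgt; apply/negP => kj; apply: ND; rewrite eD; apply: rdividesMr.
  rewrite -(conjqpK G); apply: rdivides_conj.
  have -> : conjqp G = realp (N ^+ (j - k)) * K.
    apply: (realp_lreg (Nexp_neq0 k)).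
    rewrite mulrA -realpM -exprD subnKC ?(ltnW kj) // -eFj -eF -conj_mul_nuq.
    by rewrite -mulrA -eK realp_comm.
  exists (realp (N ^+ (j - k).-1) * K).
  by rewrite mulrA -realpM -exprS prednK // subn_gt0.
rewrite -dvdp_Nexp -eFj -(rdivides_realp H) -eF {1}/nuq {1}eG mulrDl.
apply: rdividesD; first by apply/rdividesMr/rdividesMr/rdivides_self.
rewrite eG conjqpD mulrDr; apply: rdividesD.
  by rewrite conjqpM conjqp_real; apply/rdividesMl/rdividesMl/rdivides_self.
rewrite -/(nuq (D * V)) nuqM; exact: rdividesMr.
Qed.

Lemma cofactor_eq1 k G K : G \is monic -> G * K \is monic ->
  nuq G = realp (N ^+ k) -> nuq (G * K) = realp (N ^+ k) -> K = 1.
Proof.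
move=> Gm; rewrite monicMl // => Km nG; rewrite nuqM nG => nGK.
apply: monic_size1 => //; apply: (@nuq_size _ 0) => //.
by apply: (realp_lreg (Nexp_neq0 k)); rewrite nGK -realpM expr0 mulr1.
Qed.

Lemma nuq_divisor k D G : left_factor k D G -> rdivides (N ^+ k) (nuq D).
Proof. by case=> _ eG [K ->]; rewrite nuqM eG; exists (nuq K). Qed.

(** A left factor G divides N^k = G * conjqp G and D on the left, hence also the
    generator of the right ideal of N^k and D, which has the same norm. *)
Lemma left_factor_bezout k D G : ~ rdivides N D -> left_factor k D G ->
  exists U V : {poly H}, G = realp (N ^+ k) * U + D * V.
Proof.
move=> ND lG.
have [G0 [U [V [[G0m nG0 _] eG0]]]] :=
  left_factor_exists_bezout ND (nuq_divisor lG).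
case: lG => Gm nG [D1 eD].
have eK : G0 = G * (conjqp G * U + D1 * V).
  by rewrite mulrDr !mulrA -/(nuq G) nG -eD.
exists U, V; rewrite -eG0; move: (_ + _) eK => K eK.
have := @cofactor_eq1 k G K Gm; rewrite -eK => /(_ G0m nG nG0) K1.
by rewrite eK K1 mulr1.
Qed.

Lemma left_factor_uniq k D G G' : ~ rdivides N D ->
  left_factor k D G -> left_factor k D G' -> G = G'.
Proof.
move=> ND lG lG'; have [U [V eG]] := left_factor_bezout ND lG.
case: lG => Gm nG _; case: lG' => G'm nG' [D1 eD].
have eK : G = G' * (conjqp G' * U + D1 * V).
  by rewrite mulrDr !mulrA -/(nuq G') nG' -eD.
move: (_ + _) eK => K eK.
have := @cofactor_eq1 k G' K G'm; rewrite -eK => /(_ Gm nG' nG) K1.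
by rewrite eK K1 mulr1.
Qed.

(** Since N^k divides conjqp Q * D and conjqp Q * N^k, it divides conjqp Q * G
    as well. Multiplying on the right by conjqp G and cancelling N^k shows that
    conjqp G divides conjqp Q on the right. So two polynomials whose
    product conjqp Q * D cancels N^k share their left factor of norm N^k. *)
Lemma left_factor_transport k D Q G : ~ rdivides N D -> left_factor k D G ->
  rdivides (N ^+ k) (conjqp Q * D) -> ldivides G Q.
Proof.
move=> ND lG [W eW]; have [U [V eG]] := left_factor_bezout ND lG.
case: lG => Gm nG _; exists (conjqp (conjqp Q * U + W * V)).
rewrite -[Q in LHS]conjqpK -[G]conjqpK -conjqpM; congr conjqp.
apply: (monic_rreg Gm).
rewrite -mulrA conj_mul_nuq nG realp_comm eG !mulrDr !mulrA eW.
by rewrite realp_comm -!mulrA.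
Qed.

(** The scalar a covers left gcds with a quadratic N that is not monic. *)
Lemma lgcd_left_factor k a D G : a != 0 -> ~ rdivides N D ->
  left_factor k D G -> lgcd (realp (a *: N ^+ k)) D = G.
Proof.
move=> a0 ND lG; have [U [V eG]] := left_factor_bezout ND lG.
have ra (c : R) : realp (c *: N ^+ k) = realp (N ^+ k) * realp c%:P :> {poly H}.
  by rewrite -realpM mulrC mul_polyC.
case: (lG) => Gm nG [D1 eD].
have univ G' : ldivides G' (realp (a *: N ^+ k)) -> ldivides G' D ->
    exists K, G = G' * K.
  move=> [K eK] [L eL]; exists (K * realp (a^-1)%:P * U + L * V).
  rewrite mulrDr !mulrA -eK -eL -realpM.
  by rewrite -scalerAl mulrC mul_polyC scalerA mulfV // scale1r.
have lgG : is_lgcd (realp (a *: N ^+ k)) D G.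
  split=> //.
  - by exists (conjqp G * realp a%:P); rewrite mulrA -/(nuq G) nG ra.
  - by exists D1.
  move=> G' /univ h /h[K eK]; have G0 := monic_neq0 Gm.
  have : G' * K != 0 by rewrite -eK.
  rewrite hpoly_mul_eq0 negb_or => /andP[G'0 K0].
  by rewrite eK size_hpolyM // (polySpred K0) addnS leq_addr.
apply: xget_unique => // G' [G'm h1 h2 max].
have [K eK] := univ _ h1 h2.
have Km : K \is monic by have := Gm; rewrite eK (monicMl K G'm).
suff eK1 : K = 1 by rewrite eK eK1 mulr1.
have K0 := monic_neq0 Km; have G'0 := monic_neq0 G'm.
have : (size G <= size G')%N by apply: max; case: lgG.
rewrite eK size_hpolyM // (polySpred G'0) (polySpred K0) addnS /=.
rewrite -[leqRHS]addn0 leq_add2l leqn0 => /eqP sK.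
by apply: monic_size1 => //; rewrite (polySpred K0) sK.
Qed.
End LeftFactors.

(** * Dual quaternion polynomials *)

Section DualQuaternionPolynomials.
Variable R : realType.
Local Notation H := (quat R).
Local Notation DH := (dquat R).
Implicit Types (P D : {poly H}) (L M : {poly DH}) (F G : {poly R}).

Lemma primal_zmod : zmod_morphism (@primal R). Proof. by []. Qed.
HB.instance Definition _ := GRing.isZmodMorphism.Build DH H (@primal R) primal_zmod.
Lemma primal_monoid : monoid_morphism (@primal R). Proof. by []. Qed.
HB.instance Definition _ := GRing.isMonoidMorphism.Build DH H (@primal R) primal_monoid.

Lemma dual_zmod : zmod_morphism (@dual R). Proof. by []. Qed.
HB.instance Definition _ := GRing.isZmodMorphism.Build DH H (@dual R) dual_zmod.

Definition dualpart M : {poly H} := map_poly (@dual R) M.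

Lemma conjdq_zmod : zmod_morphism (@conjdq R).
Proof. by move=> [? ?] [? ?]; congr DQuat; rewrite /= raddfB. Qed.
HB.instance Definition _ := GRing.isZmodMorphism.Build DH DH (@conjdq R) conjdq_zmod.

Lemma conjdqM (x y : DH) : conjdq (x * y) = conjdq y * conjdq x.
Proof.
case: x y => [p d] [p' d']; congr DQuat; rewrite /= ?raddfD /= !conjqM //.
exact: addrC.
Qed.

Lemma conjdqK : involutive (@conjdq R).
Proof. by move=> [? ?]; rewrite /conjdq /= !conjqK. Qed.

Lemma conjdq1 : conjdq (1 : DH) = 1.
Proof. by congr DQuat; rewrite /= ?raddf0 // -[1]scale1r conjq_alg. Qed.

Lemma conjdpM L M : conjdp (L * M) = conjdp M * conjdp L.
Proof. exact: map_poly_anti conjdqM L M. Qed.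

Lemma coef_conjdp M i : (conjdp M)`_i = conjdq M`_i.
Proof. exact: coef_map. Qed.

Lemma conjdpC (a : DH) : conjdp a%:P = (conjdq a)%:P.
Proof. exact: map_polyC. Qed.

Lemma size_conjdp M : size (conjdp M) = size M.
Proof. exact: size_map_inj_poly (inv_inj conjdqK) (raddf0 (@conjdq R)) M. Qed.

Lemma conjdp_monic M : M \is monic -> conjdp M \is monic.
Proof.
move=> /monicP; rewrite monicE !lead_coefE size_conjdp coef_conjdp => ->.
by rewrite conjdq1.
Qed.

Lemma coef_primalp M i : (primalp M)`_i = primal M`_i.
Proof. exact: coef_map. Qed.

Lemma coef_dualpart M i : (dualpart M)`_i = dual M`_i.
Proof. exact: coef_map. Qed.

Lemma coef_dualp P D i : (dualp P D)`_i = DQuat P`_i D`_i.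
Proof.
rewrite /dualp coefD coefCM /of_primal !coef_map_id0 //.
by congr DQuat; rewrite /= ?mul0r ?mul1r ?mulr0 ?addr0 ?add0r.
Qed.

Lemma primalp_dualp P D : primalp (dualp P D) = P.
Proof. by apply/polyP => i; rewrite coef_primalp coef_dualp. Qed.

Lemma dualpE M : dualp (primalp M) (dualpart M) = M.
Proof.
by apply/polyP => i; rewrite coef_dualp coef_primalp coef_dualpart; case: (M`_i).
Qed.

Lemma of_primalE P : of_primal P = dualp P 0.
Proof. by apply/polyP => i; rewrite coef_dualp /of_primal coef_map_id0 // coef0. Qed.

Lemma primalp_of_primal P : primalp (of_primal P) = P.
Proof. by rewrite of_primalE primalp_dualp. Qed.

Lemma realp_dualp F : realp F = dualp (realp F) 0.
Proof.
apply/polyP => i; rewrite coef_dualp !coef_map coef0.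
by congr DQuat; rewrite /= ?scaler0.
Qed.

Lemma primalpM L M : primalp (L * M) = primalp L * primalp M.
Proof. exact: (rmorphM (map_poly (@primal R))). Qed.

Lemma dualpart_dualp P D : dualpart (dualp P D) = D.
Proof. by apply/polyP => i; rewrite coef_dualpart coef_dualp. Qed.

Lemma dualpartM L M :
  dualpart (L * M) = primalp L * dualpart M + dualpart L * primalp M.
Proof.
apply/polyP => i; rewrite coef_dualpart coefM coefD !coefM -big_split /= raddf_sum.
by apply: eq_bigr => j _; rewrite !coef_primalp !coef_dualpart.
Qed.

Lemma dualpM P D P' D' : dualp P D * dualp P' D' = dualp (P * P') (P * D' + D * P').
Proof. by rewrite -[LHS]dualpE primalpM dualpartM !primalp_dualp !dualpart_dualp. Qed.

Lemma primalp_realp F : primalp (realp F) = realp F.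
Proof. by rewrite realp_dualp primalp_dualp. Qed.

Lemma primalp_conj M : primalp (conjdp M) = conjqp (primalp M).
Proof. by apply/polyP => i; rewrite coef_primalp coef_conjdp coef_conjqp coef_primalp. Qed.

Lemma primalp_nu M : primalp (nu M) = nuq (primalp M).
Proof. by rewrite /nu primalpM primalp_conj. Qed.

Lemma primalp_monic M : M \is monic -> primalp M \is monic.
Proof. exact: (monic_map (@primal R)). Qed.

Lemma rdivides_primalp F M : rdivides F M -> rdivides F (primalp M).
Proof. by case=> K ->; exists (primalp K); rewrite primalpM primalp_realp. Qed.

Lemma nuq_primalp M F : nu M = realp F -> nuq (primalp M) = realp F.
Proof. by rewrite -primalp_nu => ->; rewrite primalp_realp. Qed.

Lemma conjdp_dualp P D : conjdp (dualp P D) = dualp (conjqp P) (conjqp D).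
Proof. by apply/polyP => i; rewrite coef_conjdp !coef_dualp !coef_conjqp. Qed.

Lemma nu_dualp P D F : nuq P = realp F -> P * conjqp D + D * conjqp P = 0 ->
  nu (dualp P D) = realp F.
Proof. by move=> nP PD; rewrite /nu conjdp_dualp dualpM PD -/(nuq P) nP -realp_dualp. Qed.

Lemma nu_of_primal P F : nuq P = realp F -> nu (of_primal P) = realp F.
Proof.
by move=> nP; rewrite of_primalE; apply: nu_dualp; rewrite // raddf0 mulr0 mul0r addr0.
Qed.

Lemma of_primal1 : of_primal (1 : {poly H}) = 1.
Proof.
have e1 : realp 1 = 1 :> {poly H} by exact: rmorph1.
have e2 : realp 1 = 1 :> {poly DH} by exact: rmorph1.
by rewrite -e1 of_primalE -realp_dualp.
Qed.

Lemma dualp_monic P D : P \is monic -> (size D < size P)%N -> dualp P D \is monic.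
Proof.
move=> Pm sD; have [P1 sP] : P`_(size P).-1 = 1 /\ (0 < size P)%N.
  by rewrite size_poly_gt0 monic_neq0 // -lead_coefE (monicP Pm).
have D1 : D`_(size P).-1 = 0 by rewrite nth_default // -ltnS prednK.
suff sPP : size (dualp P D) = size P.
  by rewrite monicE lead_coefE sPP coef_dualp P1 D1.
apply/eqP; rewrite eqn_leq; apply/andP; split.
  apply/leq_sizeP => j sj; rewrite coef_dualp !nth_default //.
  exact: leq_trans (ltnW sD) sj.
rewrite leqNgt -(prednK sP) ltnS; apply/negP => /leq_sizeP /(_ _ (leqnn _)).
rewrite coef_dualp P1 => /(congr1 (@primal R)) /eqP.
by rewrite /= oner_eq0.
Qed.

Lemma of_primal_monic P : P \is monic -> of_primal P \is monic.
Proof.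
move=> Pm; rewrite of_primalE; apply: dualp_monic => //.
by rewrite size_poly0 size_poly_gt0 monic_neq0.
Qed.

End DualQuaternionPolynomials.

(** * Linear factors of generic motion polynomials *)

Lemma linear_polyE (V : nzRingType) (r : {poly V}) :
  (size r <= 2)%N -> r = (r`_1)%:P * 'X + (r`_0)%:P.
Proof.
move=> sr; apply/polyP => -[|[|i]]; rewrite coefD coefCM coefX coefC /=.
- by rewrite mulr0 add0r.
- by rewrite mulr1 addr0.
- by rewrite mulr0 addr0 nth_default // (leq_trans sr).
Qed.

Lemma linear_poly_unitE (V : unitRingType) (r : {poly V}) :
  (size r <= 2)%N -> r`_1 \is a GRing.unit ->
  r = (r`_1)%:P * ('X - (- (r`_1)^-1 * r`_0)%:P).
Proof.
move=> sr ur; rewrite {1}(linear_polyE sr) mulrBr -polyCM mulNr mulrN mulrA.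
by rewrite mulrV // mul1r polyCN opprK.
Qed.

Lemma prod_rcons (V : nzRingType) (s : seq V) x :
  \prod_(l <- rcons s x) l = (\prod_(l <- s) l) * x.
Proof. by rewrite -cats1 big_cat big_seq1. Qed.

Section NormPower.
Variable R : realType.
Local Notation H := (quat R).
Local Notation DH := (dquat R).
Implicit Types (P D : {poly H}) (L M : {poly DH}) (F G : {poly R}).
Variable N : {poly R}.
Hypotheses (Nirr : irreducible_poly N) (Nm : N \is monic) (sN : size N = 3%N).

Lemma nu_size M d : M \is monic -> nu M = realp (N ^+ d) -> size M = d.+1.
Proof. exact: (norm_exp_size (@conjdp_monic R) (@size_conjdp R) Nm sN). Qed.

Lemma nu_mul L M F : nu M = realp F -> nu (L * M) = realp F * nu L.
Proof. exact: (norm_mul (@conjdpM R)). Qed.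

Lemma nu_cancel_l L M F G : L \is monic -> nu L = realp F ->
  nu (L * M) = realp (F * G) -> nu M = realp G.
Proof. exact: (norm_cancel_l (@conjdpM R) (@conjdp_monic R)). Qed.

Lemma nu_cancel_r L M F G : F != 0 -> nu M = realp F ->
  nu (L * M) = realp (F * G) -> nu L = realp G.
Proof. exact: (norm_cancel_r (@conjdpM R)). Qed.

(** A real divisor of the primal part divides its norm, so it is a power of N. *)
Lemma generic_nu_exp d M : M \is monic -> nu M = realp (N ^+ d) ->
  ~ rdivides N (primalp M) -> generic M.
Proof.
move=> Mm nM NM.
have F1 F : F \is monic -> rdivides F (primalp M) -> F = 1.
  move=> Fm FM; have : F %| N ^+ d.
    apply/(rdivides_realp H); rewrite -(nuq_primalp nM).
    exact: rdividesMr.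
  move=> /(dvdp_irr_exp Nirr Nm Fm)[[|j] _ eF]; first by rewrite eF expr0.
  by case: NM; apply: rdivides_trans FM; rewrite eF exprS dvdp_mulr.
split.
- exact: Mm.
- by exists (N ^+ d); [exact: (Nexp_neq0 Nm)|exact: nM].
- by apply: mrpf_eq1 => F Fm /rdivides_primalp; exact: F1.
- exact: mrpf_eq1.
Qed.

Lemma quadratic_factorE d M F : nu M = realp (N ^+ d) -> quadratic_factor M F ->
  (lead_coef F)^-1 *: F = N.
Proof.
move=> nM [_ sF]; rewrite nM rdivides_realp => FN.
have F0 : F != 0 by rewrite -size_poly_gt0 sF.
have l0 : (lead_coef F)^-1 != 0 by rewrite invr_eq0 lead_coef_eq0.
have Fm : (lead_coef F)^-1 *: F \is monic.
  by rewrite monicE lead_coefZ mulVf // lead_coef_eq0.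
have [|j _ eF] := dvdp_irr_exp Nirr Nm Fm (n := d); first by rewrite dvdpZl.
have /(congr1 predn) := congr1 (fun X : {poly R} => size X) eF.
rewrite size_scale // sF size_exp sN eF => /= e.
by have -> : j = 1%N by lia.
Qed.

(** The remainder r of M by N satisfies nu r = 0 modulo N. A vanishing primal part
    of its leading coefficient would leave a constant primal remainder of norm
    divisible by N, hence 0, against primitivity. So r is a unit multiple of
    t - h, the monic quadratic nu (t - h) is divisible by N, hence equal to N,
    and t - h divides both N and r on the right. *)
Lemma right_linear_factor d M : M \is monic -> nu M = realp (N ^+ d.+1) ->
  ~ rdivides N (primalp M) ->
  let r := rmodp M (realp N) in let h := - (r`_1)^-1 * r`_0 in
  [/\ r`_1 \is a GRing.unit, nu ('X - h%:P) = realp N &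
      exists K, M = K * ('X - h%:P)].
Proof.
move=> Mm nM NM r h.
have rNm : (realp N : {poly DH}) \is monic by rewrite realp_monic.
have eM : M = rdivp M (realp N) * realp N + r := Pdiv.RingMonic.rdivp_eq rNm M.
have sr : (size r <= 2)%N.
  by rewrite -ltnS -sN -(size_realp DH N) ltn_rmodp monic_neq0.
clearbody r; move: (rdivp _ _) eM => q eM.
have er' : r = M - q * realp N by rewrite eM addrC addKr.
have Nr : rdivides N (nu r).
  rewrite /nu {1}er' mulrBl; apply: rdividesB; last first.
    by apply/rdividesMr/rdividesMl/rdivides_self.
  have -> : conjdp r = conjdp M - conjdp (q * realp N).
    by apply/polyP => i; rewrite er' coefB !coef_conjdp coefB raddfB.
  rewrite mulrBr; apply: rdividesB.
    by rewrite -/(nu M) nM; apply/rdivides_realp; rewrite exprS dvdp_mulr.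
  rewrite conjdpM; apply: rdividesMl; apply: rdividesMr.
  rewrite realp_dualp conjdp_dualp conjqp_real raddf0 -realp_dualp.
  exact: rdivides_self.
have NPr : ~ rdivides N (primalp r).
  move=> Npr; apply: NM; rewrite eM.
  have -> : primalp (q * realp N + r) = primalp (q * realp N) + primalp r.
    by apply/polyP => i; rewrite coefD !coef_primalp coefD.
  apply: rdividesD Npr; rewrite primalpM primalp_realp.
  exact/rdividesMl/rdivides_self.
have r1 : primal r`_1 != 0.
  apply/eqP => r10; apply: NPr.
  have epr : primalp r = (primal r`_0)%:P.
    apply/polyP => -[|[|i]]; rewrite coef_primalp coefC //=.
    by rewrite nth_default // (leq_trans sr).
  move/rdivides_primalp : Nr; rewrite primalp_nu epr nuqC rdivides_realp.
  have [u0|u0] := eqVneq (primal r`_0) 0.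
    by move=> _; rewrite u0 polyC0; apply: rdivides0.
  have n0 : Defs.normq (primal r`_0) != 0 by rewrite Defs.normq_eq0.
  by move=> /dvdp_leq; rewrite polyC_eq0 n0 sN size_polyC n0 => /(_ isT).
have ur1 : r`_1 \is a GRing.unit by exact: r1.
have erh : r = (r`_1)%:P * ('X - h%:P) by exact: linear_poly_unitE.
have Xm : 'X - h%:P \is monic by exact: monicXsubC.
have c1 : conjdp (r`_1)%:P * (conjdq (r`_1)^-1)%:P = 1.
  by rewrite conjdpC -polyCM -conjdqM (mulVr ur1) conjdq1 polyC1.
have nX : nu ('X - h%:P) = realp N.
  move: ('X - h%:P) Xm (size_XsubC h) erh => X Xm sX erX.
  have [K eK] : rdivides N (nu X).
    move: Nr; rewrite erX /nu conjdpM mulrA -mulrA -mulrA => Nr.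
    have := rdividesMr (conjdq (r`_1)^-1)%:P (rdivides_unitl (mulVr ur1) Nr).
    by rewrite -!mulrA c1 mulr1.
  have Km : K \is monic.
    by have := norm_monic (@conjdp_monic R) Xm; rewrite -/(nu X) eK (monicMl K rNm).
  have := size_norm (@conjdp_monic R) (@size_conjdp R) Xm.
  rewrite -/(nu X) {1}eK (size_monicM rNm (monic_neq0 Km)) size_realp sN sX => -[sK].
  by rewrite eK (monic_size1 Km sK) mulr1.
split; [exact: ur1 | exact: nX |].
exists (q * conjdp ('X - h%:P) + (r`_1)%:P).
rewrite mulrDl -erh -mulrA.
by rewrite (norm_comm Xm nX).
Qed.

Section GFactor.
Variable chF : {poly DH} -> {poly R}.
Hypothesis hchF : valid_chF chF.

(** The primitivity of the primal part passes to the left quotient, which keeps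
    the recursion going. *)
Lemma gfactor_rec_norm d M : M \is monic -> nu M = realp (N ^+ d) ->
  ~ rdivides N (primalp M) ->
  exists s, [/\ gfactor_rec chF d M = Some s, size s = d, \prod_(l <- s) l = M &
    forall l, l \in s -> l \is monic /\ nu l = realp N].
Proof.
elim: d M => [|d IHd] M Mm nM NM; have sM := nu_size Mm nM.
  exists [::]; split=> //=; first by rewrite sM.
  by rewrite big_nil (monic_size1 Mm).
have hF : quadratic_factor M (chF M).
  apply: hchF; exists N; split=> //.
  by rewrite nM; apply/rdivides_realp; rewrite exprS dvdp_mulr.
have [] := right_linear_factor Mm nM NM.
rewrite /= sM /= /realrem (quadratic_factorE nM hF) (asboolT hF) /=.
move: (- _ * _) => h ur1 nh [K eK]; rewrite ur1 /=.
have Xm : 'X - h%:P \is monic by exact: monicXsubC.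
have Km : K \is monic by have := Mm; rewrite eK (monicMr K Xm).
have nK : nu K = realp (N ^+ d).
  apply: (nu_cancel_r (monic_neq0 Nm) nh).
  by rewrite -eK nM exprS.
have NK : ~ rdivides N (primalp K).
  by move=> NK; apply: NM; rewrite eK primalpM; apply: rdividesMr.
have [s [es ss ps hs]] := IHd K Km nK NK.
have -> : rdivp M ('X - h%:P) = K by rewrite eK (Pdiv.RingMonic.rdivp_mull Xm).
rewrite es /=; exists (rcons s ('X - h%:P)); split; first by [].
- by rewrite size_rcons ss.
- by rewrite prod_rcons ps -eK.
- move=> l; rewrite mem_rcons inE => /orP[/eqP-> | /hs hl].
    exact: (conj Xm nh).
  exact: hl.
Qed.

Lemma gfactor_norm d M : M \is monic -> nu M = realp (N ^+ d) ->
  ~ rdivides N (primalp M) ->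
  exists s, [/\ gfactor chF M = Some s, size s = d, \prod_(l <- s) l = M &
    forall l, l \in s -> l \is monic /\ nu l = realp N].
Proof.
by move=> Mm nM NM; rewrite /gfactor (nu_size Mm nM); apply: gfactor_rec_norm.
Qed.

End GFactor.

Lemma prod_norm (s : seq {poly DH}) :
  (forall l, l \in s -> l \is monic /\ nu l = realp N) ->
  \prod_(l <- s) l \is monic /\ nu (\prod_(l <- s) l) = realp (N ^+ size s).
Proof.
elim: s => [_|l s IHs hs].
  rewrite big_nil monic1; split=> //.
  by rewrite -of_primal1 (nu_of_primal (F := 1)) ?expr0 // nuq1.
have [lm nl] := hs l (mem_head l s).
have [sm ns] : \prod_(l <- s) l \is monic /\ nu (\prod_(l <- s) l) = realp (N ^+ size s).
  by apply: IHs => l' l's; apply: hs; rewrite inE l's orbT.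
rewrite big_cons (monicMl _ lm) sm; split=> //.
by rewrite (nu_mul _ ns) nl -realpM exprSr.
Qed.
End NormPower.

(** * Splitting off the generic left factor *)

Lemma inner_expand (V : nzRingType) (a b c d : V) :
  a * (b * c - c * b) + (d * a - a * d) * b = a * b * c + d * (a * b) - a * (d + c) * b.
Proof.
rewrite mulrBr mulrBl mulrDr mulrDl !mulrA addrACA opprD; congr (_ + _).
exact: addrC.
Qed.

Section LeftFactorSplit.
Variable R : realType.
Local Notation H := (quat R).
Local Notation DH := (dquat R).
Implicit Types (P D Q : {poly H}) (L M : {poly DH}) (F G : {poly R}).
Variable N : {poly R}.
Hypotheses (Nirr : irreducible_poly N) (Nm : N \is monic) (sN : size N = 3%N).

Lemma trace_sandwich_real P X F : nuq P = realp F ->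
  exists G, P * (X + conjqp X) * conjqp P = realp (F * G).
Proof.
move=> nP; have [G ->] := trace_real X; exists G.
by rewrite (realp_comm G P) -mulrA -/(nuq P) nP -realpM mulrC.
Qed.

(** The data of one splitting M = (QL + eps DL) * (N^m Q1 + eps DR) for
    M = N^m Q + eps D, where QL is the common left factor of norm N^k of Q and
    D. The choice q = 0 gives DL = 0, so both branches of the procedure are
    covered. *)
Section Split.
Variables (m k : nat) (QL Q1 D1 : {poly H}) (q : H).
Let Q := QL * Q1.
Let D := QL * D1.
Let DL := q%:P * QL - QL * q%:P.
Let DR := realp (N ^+ (m - k)) * conjqp DL * Q + D1.
Hypotheses (km : (k <= m)%N) (nQL : nuq QL = realp (N ^+ k)).

Lemma conjqp_inner : conjqp DL = conjqp QL * conjqp q%:P - conjqp q%:P * conjqp QL.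
Proof. by rewrite /DL conjqpB !conjqpM. Qed.

(** The sum is the trace of q times the norm of QL minus QL * trace * conjqp QL,
    and the trace is real. *)
Lemma inner_motion : QL * conjqp DL + DL * conjqp QL = 0.
Proof.
have [F eF] := trace_real q%:P.
rewrite conjqp_inner inner_expand -/(nuq QL) nQL (realp_comm _ q%:P) -mulrDr.
rewrite (addrC (conjqp _)) eF (realp_comm F QL) -mulrA -/(nuq QL) nQL -!realpM.
by rewrite mulrC subrr.
Qed.

Lemma left_cofactor : realp (N ^+ m) * conjqp DL * Q + conjqp QL * D = realp (N ^+ k) * DR.
Proof.
rewrite /DR mulrDr; congr (_ + _).
  by rewrite !mulrA -realpM -exprD subnKC.
by rewrite /D mulrA conj_mul_nuq nQL.
Qed.

Lemma left_cofactor_dual : QL * DR + realp (N ^+ m) * (DL * Q1) = D.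
Proof.
have e : QL * conjqp DL = - (DL * conjqp QL) by apply/eqP; rewrite -addr_eq0 inner_motion.
rewrite /DR mulrDr -/D !mulrA realp_comm -(mulrA _ QL (conjqp DL)) e.
rewrite mulrN !mulNr -!mulrA (mulrA (conjqp QL)) conj_mul_nuq nQL.
rewrite (mulrA DL) (realp_comm _ DL) -(mulrA _ DL) (mulrA (realp _) (realp _)).
by rewrite -realpM -exprD subnK // addrAC addNr add0r.
Qed.

Lemma left_split : dualp (realp (N ^+ m) * Q) D = dualp QL DL * dualp (realp (N ^+ m) * Q1) DR.
Proof.
rewrite dualpM; congr dualp.
  by rewrite /Q (mulrA QL) (realp_comm _ QL) -mulrA.
by rewrite (mulrA DL) (realp_comm _ DL) -(mulrA _ DL) left_cofactor_dual.
Qed.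

(** N divides the other summand N^m * (DL * Q1) of D, so it cannot divide DR. *)
Lemma left_cofactor_primitive : (0 < m)%N -> ~ rdivides N D -> ~ rdivides N DR.
Proof.
move=> m0 ND NDR; apply: ND; rewrite -left_cofactor_dual; apply: rdividesD.
  exact: rdividesMl.
by rewrite -(prednK m0) exprS; apply/rdividesMr/rdivides_realp/dvdp_mulr.
Qed.

(** The norm of QL * DR = D - N^m * (DL * Q1) is divisible by N^(m + k). Its
    mixed terms are N^m times the trace of Y := D * conjqp Q1 * conjqp DL.
    Inserting DL splits Y into a multiple of D * conjqp Q and a product
    QL * Z * conjqp QL, whose trace is a real multiple of N^k. *)
Lemma left_cofactor_norm :
  rdivides (N ^+ k) (D * conjqp Q) -> rdivides (N ^+ (m + k)) (nuq D) ->
  rdivides (N ^+ m) (nuq DR).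
Proof.
move=> NDQ ND.
apply: (rdivides_cancel (Nexp_neq0 Nm k)); rewrite -exprD addnC.
set Y := D * conjqp Q1 * conjqp DL.
have NY : rdivides (N ^+ k) (Y + conjqp Y).
  have -> : Y = D * conjqp Q * conjqp q%:P - QL * (D1 * conjqp Q1 * conjqp q%:P) * conjqp QL.
    by rewrite /Y conjqp_inner mulrBr /Q conjqpM /D !mulrA.
  set Z := D1 * _ * _; set W := D * _ * _.
  have [F eF] := trace_sandwich_real Z nQL.
  have -> : W - QL * Z * conjqp QL + conjqp (W - QL * Z * conjqp QL) =
      W + conjqp W - QL * (Z + conjqp Z) * conjqp QL.
    rewrite conjqpB 2!conjqpM conjqpK mulrDr mulrDl opprD !mulrA.
    exact: addrACA.
  rewrite eF; apply: rdividesB; last by apply/rdivides_realp/dvdp_mulr.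
  by apply: rdividesD; [|apply: rdivides_conj]; apply: rdividesMr.
set X := realp (N ^+ m) * (DL * Q1).
have eX : QL * DR = D - X by rewrite -left_cofactor_dual addrK.
have -> : realp (N ^+ k) * nuq DR = nuq (D - X) by rewrite -eX nuqM nQL.
rewrite nuqB; apply: rdividesD; last first.
  rewrite /X nuqM nuq_realp; apply/rdividesMr/rdivides_realp.
  by rewrite -exprM dvdp_Nexp //; lia.
apply: rdividesB => //.
have -> : D * conjqp X = realp (N ^+ m) * Y.
  by rewrite /X !conjqpM conjqp_real mulrA realp_comm !mulrA.
rewrite conjqpM conjqp_real realp_comm -mulrDr exprD.
exact: rdivides_mul2l.
Qed.

Lemma left_cofactor_reversal : realp (N ^+ k) * (conjqp Q1 * D1) = conjqp Q * D.
Proof.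
rewrite /Q /D conjqpM -mulrA (mulrA (conjqp QL)) conj_mul_nuq nQL.
by rewrite (mulrA (conjqp Q1)) (realp_comm _ (conjqp Q1)) -mulrA.
Qed.

(** When N divides conjqp Q1 * D1, the inner perturbation by q is what keeps N
    from dividing conjqp Q1 * DR: modulo N the latter is
    conjqp Q * conjqp q * Q. *)
Lemma left_cofactor_reversal_inner : k = m -> (0 < m)%N ->
  ~ rdivides N (conjqp Q * conjqp q%:P * Q) ->
  rdivides N (conjqp Q1 * D1) -> ~ rdivides N (conjqp Q1 * DR).
Proof.
move=> ekm m0 NQ ND1 NDR; apply: NQ.
have -> : conjqp Q * conjqp q%:P * Q =
    (conjqp Q1 * DR - conjqp Q1 * D1) + conjqp Q1 * conjqp q%:P * nuq QL * Q1.
  rewrite /DR ekm subnn expr0 [realp 1](rmorph1 (@realp R H)) mul1r mulrDr addrK.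
  rewrite conjqp_inner mulrBl mulrBr /Q conjqpM -(conj_mul_nuq QL) !mulrA.
  by rewrite subrK.
apply: rdividesD; first exact: rdividesB.
rewrite nQL ekm; apply: rdividesMr; apply: rdividesMl; apply/rdivides_realp.
by rewrite -(prednK m0) exprS dvdp_mulr.
Qed.

End Split.
End LeftFactorSplit.

(** * Splitting the right cofactor *)

Lemma prod_take_drop (V : nzRingType) (s : seq V) m :
  \prod_(l <- s) l = \prod_(l <- take m s) l * \prod_(l <- drop m s) l.
Proof. by rewrite -{1}(cat_take_drop m s) big_cat. Qed.

Lemma conj_linear (V : unitRingType) (p q : V) : q \is a GRing.unit ->
  'X - (q * p * q^-1)%:P = q%:P * ('X - p%:P) * (q^-1)%:P.
Proof.
move=> uq; rewrite mulrBr mulrBl -!polyCM; congr (_ - _).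
by rewrite commr_polyX -mulrA -polyCM mulrV // mulr1.
Qed.

Lemma conj_linear_factor (V : unitRingType) (p q : V) (K : {poly V}) :
  q \is a GRing.unit ->
  q%:P * (('X - p%:P) * K) = ('X - (q * p * q^-1)%:P) * (q%:P * K).
Proof.
move=> uq; rewrite conj_linear // -!mulrA; congr (_ * (_ * _)).
by rewrite mulrA -polyCM mulVr // mul1r.
Qed.

Section RightSplit.
Variable R : realType.
Local Notation H := (quat R).
Local Notation DH := (dquat R).
Implicit Types (P D Q : {poly H}) (L M : {poly DH}) (F G : {poly R}).
Variable N : {poly R}.
Hypotheses (Nirr : irreducible_poly N) (Nm : N \is monic) (sN : size N = 3%N).
Variable chF : {poly DH} -> {poly R}.
Hypothesis hchF : valid_chF chF.

Lemma left_factor_lgcd k D : ~ rdivides N D -> rdivides (N ^+ k) (nuq D) ->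
  left_factor N k D (lgcd (realp (N ^+ k)) D).
Proof.
move=> ND NkD; have [G [U [V [lG _]]]] := left_factor_exists_bezout Nirr Nm sN ND NkD.
have := lgcd_left_factor Nirr Nm sN (oner_neq0 R) ND lG.
by rewrite scale1r => ->.
Qed.

(** Qc has norm N^m and DR = Qc * D2, so Qc splits off on the left and leaves
    Mr := conjqp Qc * Q1 + eps D2. If N divided conjqp Qc * Q1, it would divide
    conjqp Q1 * Qc * D2 = conjqp Q1 * DR; hence Mr is generic and factors into
    linear motion polynomials. The product of the first m of them has as primal
    part a left factor of conjqp Qc * Q1 of norm N^m, which by uniqueness is
    conjqp Qc. So the primal part of the central factor is Qc * conjqp Qc. *)
Lemma right_split m e Q1 DR : nuq Q1 = realp (N ^+ e) ->
  dualp (realp (N ^+ m) * Q1) DR \is monic ->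
  nu (dualp (realp (N ^+ m) * Q1) DR) = realp (N ^+ (m + (m + e))) ->
  ~ rdivides N DR -> rdivides (N ^+ m) (nuq DR) ->
  ~ rdivides N (conjqp Q1 * DR) ->
  let Qc := lgcd (realp (N ^+ m)) DR in
  exists D2 s,
    [/\ conjqp Qc * DR = realp (N ^+ m) * D2,
        gfactor chF (dualp (conjqp Qc * Q1) D2) = Some s,
        size s = (m + e)%N &
    let MC1 := \prod_(l <- take m s) l in let MR := \prod_(l <- drop m s) l in
    [/\ dualp (realp (N ^+ m) * Q1) DR = of_primal Qc * MC1 * MR,
        [/\ of_primal Qc \is monic, MC1 \is monic & MR \is monic],
        [/\ nu (of_primal Qc) = realp (N ^+ m), nu MC1 = realp (N ^+ m) &
            nu MR = realp (N ^+ e)],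
        [/\ generic (of_primal Qc), generic MC1 & generic MR] &
        primalp (of_primal Qc * MC1) = realp (N ^+ m)]].
Proof.
move=> nQ1 M'm nM' NDR NmDR NQD Qc.
have lQc : left_factor N m DR Qc := left_factor_lgcd NDR NmDR.
clearbody Qc; have [Qcm nQc [D2 eDR]] := lQc.
have eD2 : conjqp Qc * DR = realp (N ^+ m) * D2.
  by rewrite eDR mulrA conj_mul_nuq nQc.
set Mr := dualp (conjqp Qc * Q1) D2.
have eM' : dualp (realp (N ^+ m) * Q1) DR = of_primal Qc * Mr.
  by rewrite of_primalE /Mr dualpM mul0r addr0 mulrA -/(nuq Qc) nQc -eDR.
have oQcm := of_primal_monic Qcm; have noQc := nu_of_primal nQc.
have Mrm : Mr \is monic by have := M'm; rewrite eM' (monicMl _ oQcm).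
have nMr : nu Mr = realp (N ^+ (m + e)).
  by apply: (nu_cancel_l oQcm noQc); rewrite -eM' nM' exprD.
have NP : ~ rdivides N (conjqp Qc * Q1).
  move=> /rdivides_conj; rewrite conjqpM conjqpK => NQ.
  by apply: NQD; rewrite eDR mulrA; apply: rdividesMr.
have pMr : primalp Mr = conjqp Qc * Q1 by rewrite primalp_dualp.
have NMr : ~ rdivides N (primalp Mr) by rewrite pMr.
have [s [es ss ps hs]] := gfactor_norm Nirr Nm sN hchF Mrm nMr NMr.
exists D2, s; split; [exact: eD2 | exact: es | exact: ss | move=> MC1 MR].
have sT : size (take m s) = m by rewrite size_takel // ss leq_addr.
have sD : size (drop m s) = e by rewrite size_drop ss addKn.
have [|MC1m nMC1] := @prod_norm R N (take m s).
  by move=> l /mem_take; apply: hs.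
have [|MRm nMR] := @prod_norm R N (drop m s).
  by move=> l /mem_drop; apply: hs.
have eMr : Mr = MC1 * MR by rewrite -ps; apply: prod_take_drop.
rewrite -/MC1 sT in MC1m nMC1; rewrite -/MR sD in MRm nMR.
clearbody MC1 MR Mr.
have epr : conjqp Qc * Q1 = primalp MC1 * primalp MR by rewrite -pMr eMr primalpM.
have eT : primalp MC1 = conjqp Qc.
  apply: (left_factor_uniq Nirr Nm sN NP (k := m)); split.
  - exact: (primalp_monic MC1m).
  - exact: (nuq_primalp nMC1).
  - by exists (primalp MR); exact: epr.
  - exact: (conjqp_monic Qcm).
  - by rewrite nuq_conj; exact: nQc.
  - by exists Q1.
split.
- by rewrite eM' eMr mulrA.
- exact: And3 oQcm MC1m MRm.
- exact: And3 noQc nMC1 nMR.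
- split.
  + apply: (generic_nu_exp Nirr Nm oQcm noQc); rewrite primalp_of_primal.
    by move=> NQc; apply: NDR; rewrite eDR; apply: rdividesMr.
  + apply: (generic_nu_exp Nirr Nm MC1m nMC1) => NMC1.
    by apply: NP; rewrite epr; apply: rdividesMr.
  + apply: (generic_nu_exp Nirr Nm MRm nMR) => NMR.
    by apply: NP; rewrite epr; apply: rdividesMl.
- by rewrite primalpM primalp_of_primal eT -/(nuq Qc).
Qed.

Lemma quat_central (p : H) : (forall q, q * p = p * q) -> p = qre p *: 1.
Proof.
move=> hp; case: p hp => a b c d hp.
have [_ _ h1 h2] := hp (Quat 0 1 0 0); have [_ h3 _ h4] := hp (Quat 0 0 1 0).
by congr Quat => /=; lra.
Qed.

(** A central p is real, and then the irreducible N would be a square. *)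
Lemma linear_factor_noncentral (p : H) : nuq ('X - p%:P) = realp N ->
  exists q, q * p <> p * q.
Proof.
move=> np; apply: contrapT => nex.
have pc : p = qre p *: 1.
  by apply: quat_central => q; apply: contrapT => qp; apply: nex; exists q.
have eX : 'X - p%:P = realp ('X - (qre p)%:P).
  by rewrite rmorphB /= /realp map_polyX map_polyC /= -pc.
have eN : ('X - (qre p)%:P) ^+ 2 = N.
  by apply: (@realp_inj R H); rewrite -nuq_realp -eX np.
have : 'X - (qre p)%:P %| N by rewrite -eN dvdp_mulr.
move=> /(Nirr.2 _ _); rewrite size_XsubC => /(_ isT) /eqp_size.
by rewrite size_XsubC sN.
Qed.

(** If N divided the product, Q and q * Q would have the same left factor t - p
    of norm N. But t - q p q^-1 is a left factor of q * Q, so uniqueness would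
    make q and p commute. *)
Lemma noncommuting_conjugate_primitive Q (p q : H) :
  ~ rdivides N Q -> left_factor N 1 Q ('X - p%:P) -> q * p <> p * q ->
  ~ rdivides N (conjqp Q * conjqp q%:P * Q).
Proof.
move=> NQ lQ qp; rewrite -conjqpM => NQQ.
have q0 : q != 0 by apply: contra_not_neq qp => ->; rewrite mul0r mulr0.
have uq : q \is a GRing.unit by rewrite quat_unit.
have NqQ : ~ rdivides N (q%:P * Q) by move=> /(rdivides_unitl (mulVr uq)).
have [Xm nX [K eQ]] := lQ.
have lqQ : left_factor N 1 (q%:P * Q) ('X - p%:P).
  by split=> //; apply: (left_factor_transport Nirr Nm sN NQ lQ).
have l'qQ : left_factor N 1 (q%:P * Q) ('X - (q * p * q^-1)%:P).
  split; first exact: monicXsubC.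
    rewrite (conj_linear _ uq) !nuqM nX realp_comm -mulrA -nuqM -polyCM mulrV //.
    by rewrite polyC1 nuq1 -realpM mulr1.
  by exists (q%:P * K); rewrite eQ; apply: conj_linear_factor.
have /addrI/oppr_inj/polyC_inj e := left_factor_uniq Nirr Nm sN NqQ lqQ l'qQ.
by apply: qp; rewrite [in RHS]e mulrVK.
Qed.

End RightSplit.

(** * The factorization procedure *)

Lemma size_inner (V : nzRingType) (A : {poly V}) (q : V) :
  A \is monic -> (size (q%:P * A - A * q%:P)%R < size A)%N.
Proof.
move=> Am; rewrite (polySpred (monic_neq0 Am)) ltnS; apply/leq_sizeP => j.
rewrite leq_eqVlt coefB coefCM coefMC => /orP[/eqP<-|jA].
  by rewrite -lead_coefE (monicP Am) mul1r mulr1 subrr.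
by rewrite nth_default ?mul0r ?mulr0 ?subrr // (polySpred (monic_neq0 Am)).
Qed.

Section Factor3.
Variable R : realType.
Local Notation H := (quat R).
Local Notation DH := (dquat R).
Implicit Types (P D Q : {poly H}) (L M : {poly DH}) (F G : {poly R}).
Variable N : {poly R}.
Hypotheses (Nirr : irreducible_poly N) (Nm : N \is monic) (sN : size N = 3%N).
Variables (chF : {poly DH} -> {poly R}) (chq : H -> H).
Hypotheses (hchF : valid_chF chF) (hchq : valid_chq chq).

Lemma rdivides_scale (a : R) (V : lalgType R) (A : {poly V}) :
  a != 0 -> rdivides (a *: N) A <-> rdivides N A.
Proof.
move=> a0; split; last exact: rdividesZ.
by apply: rdivides_trans; rewrite dvdpZr.
Qed.

(** Either branch returns the commutator of some q with QL, where q = 0 stands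
    for the second one; the dichotomy records what the choice of q achieves. *)
Lemma factor3_left_spec (a : R) k Q D S : a != 0 -> ~ rdivides N Q ->
  rdivides N (nuq Q) -> conjqp Q * D = realp (N ^+ k) * S ->
  let QL := lgcd (realp (N ^+ k)) Q in
  exists q, factor3_left chq (a *: N) (N ^+ k) Q D =
      Some (QL, q%:P * QL - QL * q%:P) /\
    (~ rdivides N S /\ q = 0 \/
     rdivides N S /\ ~ rdivides N (conjqp Q * conjqp q%:P * Q)).
Proof.
move=> a0 NQ NnQ eS QL.
rewrite /factor3_left -/QL (realquoE (Nexp_neq0 Nm k) eS) /=.
case: asboolP => [/(rdivides_scale _ a0) NS|NS]; last first.
  exists 0; split; last by left; split=> // NS'; apply/NS/rdivides_scale.
  by rewrite polyC0 mul0r mulr0 subrr.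
have [|G [U [V [lG _]]]] := left_factor_exists_bezout Nirr Nm sN NQ (k := 1).
  by rewrite expr1.
have := lgcd_left_factor Nirr Nm sN a0 NQ lG; rewrite expr1 => ->.
have [Gm nG _] := lG; have sG := nuq_size Nm sN Gm nG.
have eG : G = 'X - (- G`_0)%:P.
  have sG2 : (size G <= 2)%N by rewrite sG.
  have G1 : G`_1 = 1 by move/monicP: Gm; rewrite lead_coefE sG.
  by rewrite {1}(linear_polyE sG2) G1 mul1r polyCN opprK.
move: (- G`_0) eG => p eG.
rewrite expr1 eG in nG; rewrite eG in lG *.
have nc := hchq (linear_factor_noncentral Nirr sN nG).
exists (chq p); rewrite eqxx /=; split; last first.
  by right; split=> //; apply: (noncommuting_conjugate_primitive Nirr Nm sN NQ lG nc).
by case: eqP.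
Qed.

(** The theorem in terms of exponents, with N monic and the possibly non-monic
    input a *: N; the assumption on N^(k + 1) says that N^k is the greatest power
    of N dividing both N^m and conjqp Q * D. *)
Lemma factor3_correct (a : R) m k e Q D : a != 0 -> (0 < m)%N -> (k <= m)%N ->
  let M := dualp (realp (N ^+ m) * Q) D in
  M \is monic -> nu M = realp (N ^+ (m + (m + e))) ->
  Q \is monic -> nuq Q = realp (N ^+ e) ->
  ~ rdivides N Q -> ~ rdivides N D ->
  rdivides (N ^+ k) (conjqp Q * D) ->
  (rdivides (N ^+ k.+1) (conjqp Q * D) -> k = m) ->
  rdivides (N ^+ k) (D * conjqp Q) -> rdivides (N ^+ (m + k)) (nuq D) ->
  exists ML MC MR : {poly DH},
    [/\ factor3 chF chq (a *: N) (N ^+ m) (N ^+ k) Q D = Some (ML, MC, MR),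
        [/\ ML \is monic, MC \is monic & MR \is monic],
        [/\ motion ML, motion MC & motion MR],
        M = ML * MC * MR &
        [/\ generic ML, generic MR,
            exists D' : {poly H}, MC = dualp (realp (N ^+ m)) D' &
            exists A B : {poly DH},
              [/\ generic A, generic B & MC = A * B]]].
Proof.
move=> a0 m0 km M Mm nM Qm nQ NQ ND NQD kmax NDQ NnD.
have mot j (X : {poly DH}) : nu X = realp (N ^+ j) -> motion X.
  by move=> nX; exists (N ^+ j); [exact: (Nexp_neq0 Nm) | exact: nX].
(* N^k divides Q * (conjqp Q * D) = N^e * D, and D is primitive *)
have ke : (k <= e)%N.
  rewrite leqNgt; apply/negP => ek; apply: ND.
  have : rdivides (N ^+ e * N) (realp (N ^+ e) * D).
    rewrite -nQ /nuq -mulrA; apply: rdividesMl; rewrite -exprSr.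
    by apply: rdivides_trans NQD; rewrite dvdp_Nexp.
  exact: (rdivides_cancel (Nexp_neq0 Nm e)).
have finish j Qc MC1 : generic (of_primal Qc) -> generic MC1 ->
    of_primal Qc \is monic -> MC1 \is monic -> nu (of_primal Qc) = realp (N ^+ j) ->
    nu MC1 = realp (N ^+ j) -> primalp (of_primal Qc * MC1) = realp (N ^+ m) ->
    [/\ of_primal Qc * MC1 \is monic, motion (of_primal Qc * MC1),
        exists D' : {poly H}, of_primal Qc * MC1 = dualp (realp (N ^+ m)) D' &
        exists A B : {poly DH},
          [/\ generic A, generic B & of_primal Qc * MC1 = A * B]].
  move=> gQ g1 Qcm m1 nQc n1 pc; split.
  - by rewrite (monicMl _ Qcm).
  - apply: (mot (j + j)%N); rewrite (nu_mul _ n1) nQc -realpM exprD; exact: erefl.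
  - exists (dualpart (of_primal Qc * MC1)).
    by rewrite -[LHS]dualpE pc.
  - by exists (of_primal Qc), MC1.
have half : (size (N ^+ m)).-1./2 = m by rewrite size_exp sN mul2n doubleK.
rewrite /factor3; case: eqP => sQ.
  have e0 : e = 0%N by have := nuq_size Nm sN Qm nQ; rewrite sQ => -[].
  have k0 : k = 0%N by apply/eqP; rewrite -leqn0 -e0.
  rewrite e0 in nM nQ; rewrite k0 in NnD kmax.
  have NQD' : ~ rdivides N (conjqp Q * D).
    by rewrite -(expr1 N) => /kmax m00; move: m0; rewrite -m00.
  rewrite addn0 in NnD.
  have [D2 [s [_ _ ss [eM [Qcm m1 mR] [nQc n1 nR] [gQ g1 gR] pc]]]] :=
    right_split Nirr Nm sN hchF nQ Mm nM ND NnD NQD'.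
  (* all m linear factors go into the central factor *)
  have eR : \prod_(l <- drop m s) l = 1 by rewrite drop_oversize ?ss ?addn0 // big_nil.
  rewrite eR in eM gR mR nR.
  rewrite mulr1 in eM.
  have [c1 c2 c3 c4] := finish _ _ _ gQ g1 Qcm m1 nQc n1 pc.
  exists 1, M, 1; rewrite -eM in c1 c2 c3 c4.
  split; [exact: erefl | exact: (And3 mR c1 mR) | exact: (And3 (mot _ _ nR) c2 (mot _ _ nR)) | | ].
    by rewrite mul1r mulr1.
  exact: (And4 gR gR c3 c4).
have e0 : (0 < e)%N.
  rewrite lt0n; apply/eqP => e0; apply: sQ.
  by rewrite (nuq_size Nm sN Qm nQ) e0.
have NnQ : rdivides N (nuq Q).
  by rewrite nQ; apply/rdivides_realp; rewrite -(prednK e0) exprS dvdp_mulr.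
have [S eS] := NQD.
have [q [-> hq]] := factor3_left_spec a0 NQ NnQ eS.
have NkQ : rdivides (N ^+ k) (nuq Q) by rewrite nQ; apply/rdivides_realp; rewrite dvdp_Nexp.
have lQL := left_factor_lgcd Nirr Nm sN NQ NkQ.
move: (lgcd _ Q) lQL => QL lQL; have [QLm nQL [Q1 eQ]] := lQL.
(* conjqp Q * D cancels N^k, so D starts with the same left factor as Q *)
have [D1 eD] : ldivides QL D.
  apply: (left_factor_transport Nirr Nm sN NQ lQL).
  by have := rdivides_conj NQD; rewrite conjqpM conjqpK.
have NQL : ~ rdivides N QL by move=> h; apply: NQ; rewrite eQ; apply: rdividesMr.
have nQ1 : nuq Q1 = realp (N ^+ (e - k)).
  apply: (realp_lreg (Nexp_neq0 Nm k)).
  by rewrite -nQL -nuqM -eQ nQ nQL -realpM -exprD subnKC.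
rewrite eQ eD in eS NDQ NnD ND hq.
have eS1 : S = conjqp Q1 * D1.
  apply: (realp_lreg (Nexp_neq0 Nm k)).
  by rewrite -eS (left_cofactor_reversal Q1 D1 nQL).
have eDR := left_cofactor Q1 D1 q km nQL.
have eM := left_split Q1 D1 q km nQL.
have NDR := @left_cofactor_primitive _ _ _ _ _ Q1 _ q km nQL m0 ND.
have NnDR := left_cofactor_norm Nm sN q km nQL NDQ NnD.
have NQ1DR : ~ rdivides N (conjqp Q1 *
   (realp (N ^+ (m - k)) * conjqp (q%:P * QL - QL * q%:P) * (QL * Q1) + D1)).
  case: hq => [[NS ->]|[NS NQqQ]].
    by rewrite polyC0 mul0r mulr0 subrr raddf0 mulr0 mul0r add0r -eS1.
  have ekm : k = m.
    apply: kmax; rewrite eQ eD eS exprSr; exact: rdivides_mul2l.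
  by rewrite eS1 in NS; apply: left_cofactor_reversal_inner.
have dLs := size_inner q QLm.
have nL := nu_dualp nQL (inner_motion q nQL).
rewrite /factor3_right /= eQ eD.
have eQ1 : conjqp QL * (QL * Q1) = realp (N ^+ k) * Q1 by rewrite mulrA conj_mul_nuq nQL.
rewrite (realquoE (Nexp_neq0 Nm k) eDR) (realquoE (Nexp_neq0 Nm k) eQ1) /=.
rewrite /M eQ eD eM in Mm nM *.
move: (q%:P * QL - QL * q%:P) eM NDR NnDR eDR NQ1DR dLs nL Mm nM => DL.
move: (_ + D1) => DR eM NDR NnDR eDR NQ1DR dLs nL Mm nM.
have Lm := dualp_monic QLm dLs.
have M'm : dualp (realp (N ^+ m) * Q1) DR \is monic by have := Mm; rewrite (monicMl _ Lm).
have nM' : nu (dualp (realp (N ^+ m) * Q1) DR) = realp (N ^+ (m + (m + (e - k)))).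
  apply: (nu_cancel_l Lm nL); rewrite nM -exprD; congr (realp (N ^+ _)); lia.
have [D2 [s [eD2 es ss [eM' [Qcm m1 mR] [nQc n1 nR] [gQ g1 gR] pc]]]] :=
  right_split Nirr Nm sN hchF nQ1 M'm nM' NDR NnDR NQ1DR.
rewrite (realquoE (Nexp_neq0 Nm m) eD2) /= es /= half.
have [c1 c2 c3 c4] := finish _ _ _ gQ g1 Qcm m1 nQc n1 pc.
have gL : generic (dualp QL DL).
  by apply: (generic_nu_exp Nirr Nm Lm nL); rewrite primalp_dualp.
eexists; eexists; eexists; split; first exact: erefl.
- exact: (And3 Lm c1 mR).
- exact: (And3 (mot _ _ nL) c2 (mot _ _ nR)).
- by rewrite eM' mulrA.
- exact: (And4 gL gR c3 c4).
Qed.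

End Factor3.

Theorem proposition5 (R : realType)
    (chF : {poly dquat R} -> {poly R}) (chq : quat R -> quat R)
    (hchF : valid_chF chF) (hchq : valid_chq chq)
    (M : {poly dquat R}) (P D Q : {poly quat R}) (c N g : {poly R}) (n : nat)
    (hM : M = dualp P D) (hbounded : bounded M)
    (hdeg : size M = n.+1) (hn : (1 < n)%N)
    (hc : c = mrpf P P) (hcpos : (0 < (size c).-1)%N)
    (hP : P = realp c * Q)
    (hNirr : irreducible_poly N) (hNquad : size N = 3%N)
    (hnu : nu M = realp (N ^+ n))
    (hg : g = mrpf (realp c) (conjqp Q * D))
    (hgdvd : g %| mrpf (realp c) (D * conjqp Q))
    (hcg : rdivides (c * g) (nuq D)) :
  exists ML MC MR : {poly dquat R},
    [/\ factor3 chF chq N c g Q D = Some (ML, MC, MR),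
        [/\ ML \is monic, MC \is monic & MR \is monic],
        [/\ motion ML, motion MC & motion MR],
        M = ML * MC * MR &
        [/\ generic ML, generic MR,
            exists D' : {poly quat R}, MC = dualp (realp c) D' &
            exists A B : {poly dquat R},
              [/\ generic A, generic B & MC = A * B]]].
Proof.
have [Mm Mmot Mred _] := hbounded.
have NN0 : N != 0 by rewrite -size_poly_gt0 hNquad.
(* N need not be monic: for even n its leading coefficient may be -1 *)
set a := lead_coef N; have a0 : a != 0 by rewrite lead_coef_eq0.
have ai0 : a^-1 != 0 by rewrite invr_eq0.
pose N0 := a^-1 *: N.
have eN : N = a *: N0 by rewrite /N0 scalerA mulfV // scale1r.
have N0m : N0 \is monic by rewrite monicE lead_coefZ mulVf.
have sN0 : size N0 = 3%N by rewrite size_scale.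
have N0irr : irreducible_poly N0.
  split=> [|q sq]; first by rewrite sN0.
  rewrite /N0 dvdpZr // => /(hNirr.2 _ sq) qN.
  by apply: eqp_trans qN _; rewrite eqp_sym eqp_scale.
have nM : nu M = realp (N0 ^+ n).
  rewrite hnu; congr (realp _).
  have : N ^+ n \is monic.
    rewrite -(realp_monic (dquat R)) -hnu.
    exact: (norm_monic (@conjdp_monic R)).
  rewrite eN exprZn => /monicP; rewrite lead_coefZ.
  by rewrite (monicP (monic_exp n N0m)) mulr1 => ->; rewrite scale1r.
clearbody a N0.
have ePM : primalp M = P by rewrite hM primalp_dualp.
have Pm : P \is monic by rewrite -ePM; apply: primalp_monic.
have nP : nuq P = realp (N0 ^+ n) by rewrite -ePM; apply: nuq_primalp.
have [cm _ _ cmax] : is_mrpf P P c by rewrite hc; apply: mrpfP; apply: monic_neq0.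
have rcm : (realp c : {poly quat R}) \is monic by rewrite realp_monic.
have Qm : Q \is monic by have := Pm; rewrite hP (monicMl Q rcm).
have [F nQ] := nuq_real Q.
have Fm : F \is monic by rewrite -(realp_monic (quat R)) -nQ (norm_monic (@conjqp_monic R)).
have ecF : N0 ^+ n = c ^+ 2 * F.
  by apply: (@realp_inj R (quat R)); rewrite -nP hP nuqM nuq_realp nQ realpM.
have [|m _ ec] := dvdp_irr_exp N0irr N0m cm (n := n).
  by rewrite ecF expr2 -mulrA dvdp_mulr.
have [|e _ eF] := dvdp_irr_exp N0irr N0m Fm (n := n); first by rewrite ecF dvdp_mull.
have en : n = (m + (m + e))%N.
  by apply: (Nexp_inj sN0); rewrite /= !exprD mulrA -expr2 -ec -eF.
have m0 : (0 < m)%N.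
  by rewrite lt0n; apply/eqP => m0; move: hcpos; rewrite ec m0 expr0 size_poly1.
have NQ : ~ rdivides N0 Q.
  move=> [K eK]; have : N0 ^+ m.+1 %| c.
    by apply: cmax; rewrite hP eK mulrA -realpM ec -exprSr; apply: rdivides_mull.
  by rewrite ec (dvdp_Nexp sN0) ltnn.
have ND : ~ rdivides N0 D.
  move=> [K eK]; have [_ _ _ max] := mrpfP M (monic_neq0 Mm).
  have N0M : rdivides N0 M.
    exists (dualp (realp (N0 ^+ m.-1) * Q) K).
    rewrite (realp_dualp N0) dualpM mul0r addr0 -eK mulrA -realpM -exprS prednK //.
    by rewrite -ec -hP.
  have := max _ N0M N0M.
  rewrite Mred -(expr1 N0) -(expr0 N0) (dvdp_Nexp sN0) //.
have c0 := monic_neq0 rcm.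
have [gm gc gQD gmax] : is_mrpf (realp c) (conjqp Q * D) g by rewrite hg; apply: mrpfP.
have [|k km ek] := dvdp_irr_exp N0irr N0m gm (n := m).
  by move/rdivides_realp : gc; rewrite ec.
have kmax : rdivides (N0 ^+ k.+1) (conjqp Q * D) -> k = m.
  move=> NkQD; apply/eqP; rewrite eqn_leq km leqNgt; apply/negP => ltkm.
  have : N0 ^+ k.+1 %| g.
    by apply: gmax => //; apply/rdivides_realp; rewrite ec (dvdp_Nexp sN0).
  by rewrite ek (dvdp_Nexp sN0) ltnn.
have gDQ : rdivides g (D * conjqp Q).
  have [_ _ h _] := mrpfP (D * conjqp Q) c0.
  exact: rdivides_trans hgdvd h.
rewrite hP in hM.
rewrite ec ek -exprD in hcg; rewrite ek in gQD gDQ.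
rewrite hM {1}eN ec ek in Mm nM *; rewrite en in nM; rewrite eF in nQ.
exact: (factor3_correct N0irr N0m sN0 hchF hchq a0 m0 km Mm nM Qm nQ NQ ND gQD kmax gDQ hcg).
Qed.
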